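(* Let $\lambda<0$ be real and let $(\mathbb{D}^2,\mathscr{F},\{0\})$ be the singular holomorphic foliation on the unit bidisc $\mathbb{D}^2$ defined by the linear vector field $Z(z,w)=z\,\frac{\partial}{\partial z}+\lambda\,w\,\frac{\partial}{\partial w}$. Let $T$ be a harmonic current directed by $\mathscr{F}$, of finite mass on $\mathbb{D}^2$, which does not give mass to any of the two separatrices $(z=0)$ and $(w=0)$, and whose trivial extension $\tilde T$ by $0$ across the origin is $dd^c$-closed on $\mathbb{D}^2$. If $T$ is periodic, i.e. $T$ is invariant under $(z,w)\mapsto(z,e^{2k\pi i\lambda}w)$ for some integer $k>0$, then the Lelong number $\mathscr{L}(T,0)$ of $T$ at $0$ is $0$. In particular, this holds for every such $T$ (with no periodicity assumption) when $\lambda\in\mathbb{Q}_{<0}$.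
   Context: $\mathbb{D}$ is the open unit disc in $\mathbb{C}$ and $r\mathbb{D}^2=\{(z,w): |z|<r,|w|<r\}$. The leaves of $\mathscr{F}$ on $\mathbb{D}^2\setminus\{0\}$ are the integral curves of $Z$: the two separatrices $\{z=0\}\setminus\{0\}$, $\{w=0\}\setminus\{0\}$, and the leaves $L_\alpha\cap\mathbb{D}^2$, $\alpha\in\mathbb{C}^*$, where $L_\alpha=\{(e^{i\zeta},\alpha e^{i\lambda\zeta}):\zeta\in\mathbb{C}\}$. The monodromy group around the singularity is generated by $(z,w)\mapsto(z,e^{2\pi i\lambda}w)$. Let $\mathscr{C}_{\mathscr F}$ (resp. $\mathscr{C}^{1,1}_{\mathscr F}$) be the space of functions (resp. $(1,1)$-forms) defined on the leaves, compactly supported in $\mathbb{D}^2\setminus\{0\}$, leafwise smooth and transversally continuous. A form in $\mathscr{C}^{1,1}_{\mathscr F}$ is positive if its restriction to every plaque is a positive $(1,1)$-form. A directed harmonic current $T$ on $\mathscr{F}$ is a continuous linear form on $\mathscr{C}^{1,1}_{\mathscr F}$ such that (1) $T(i\partial\bar\partial f)=0$ for all $f\in\mathscr{C}_{\mathscr F}$ (with $\partial\bar\partial$ taken along the leaves), and (2) $T(\iota)\ge 0$ for all positive $\iota\in\mathscr{C}^{1,1}_{\mathscr F}$. By restricting test forms to leaves, $T$ defines a positive current of bidimension $(1,1)$ on $\mathbb{D}^2\setminus\{0\}$; in a flow box with transversal $\mathbb{T}$ it has the form $T=\int_{\alpha\in\mathbb{T}}h_\alpha[P_\alpha]\,d\mu(\alpha)$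 with $h_\alpha$ positive harmonic functions on the plaques $P_\alpha$ and $\mu$ a positive Borel measure on $\mathbb{T}$. With $\beta=i\,dz\wedge d\bar z+i\,dw\wedge d\bar w$, the mass of $T$ on $V\subset\mathbb{D}^2$ is $\|T\|_V=\int_V T\wedge\beta$. The Lelong number of $T$ at $0$ is $\mathscr{L}(T,0)=\limsup_{r\to0+}\frac{1}{\pi r^2}\|T\|_{r\mathbb{D}^2}$. *)

(* Defs.v *)
From mathcomp Require Import all_boot all_order all_algebra.
From mathcomp Require Import all_classical all_reals all_analysis.

Set Implicit Arguments.
Unset Strict Implicit.
Unset Printing Implicit Defensive.

Import Order.TTheory GRing.Theory Num.Theory.
Import numFieldNormedType.Exports.

Local Open Scope classical_set_scope.
Local Open Scope ring_scope.

(* A complex number x + iy is the pair (x, y), so that C^2 is a normed module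
   over R and real differentiation is the one of the library. *)
Notation C1 R := (R * R)%type.
Notation C2 R := (C1 R * C1 R)%type.

Section Complex.
Variable R : realType.

Definition cmul (a b : C1 R) : C1 R :=
  (a.1 * b.1 - a.2 * b.2, a.1 * b.2 + a.2 * b.1).

Definition cmod (a : C1 R) : R := Num.sqrt (a.1 ^+ 2 + a.2 ^+ 2).

Definition cexp (a : C1 R) : C1 R :=
  (expR a.1 * cos a.2, expR a.1 * sin a.2).

Definition ci : C1 R := (0, 1).

Definition c2scale (a : C1 R) (p : C2 R) : C2 R := (cmul a p.1, cmul a p.2).

Definition polydisc (r : R) : set (C2 R) :=
  [set p | cmod p.1 < r /\ cmod p.2 < r].

Definition bidisc : set (C2 R) := polydisc 1.

Definition punctured_bidisc : set (C2 R) := bidisc `\ (0 : C2 R).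

Definition compactly_supported_in (A : set (C2 R)) (f : C2 R -> R) : Prop :=
  exists K : set (C2 R), [/\ compact K, K `<=` A & forall p, ~ K p -> f p = 0].

End Complex.

Section AmbientCalculus.
Variable R : realType.

Fixpoint iter_derive (vs : seq (C2 R)) (f : C2 R -> R) : C2 R -> R :=
  if vs is v :: vs' then 'D_v (iter_derive vs' f) else f.

Definition smooth (f : C2 R -> R) : Prop :=
  forall vs : seq (C2 R), continuous (iter_derive vs f) /\
    forall p v, derivable (iter_derive vs f) p v.

(* Real 2-forms on C^2, as functions of the point and two tangent vectors. *)
Definition form2 : Type := C2 R -> C2 R -> C2 R -> R.

(* The (1,1)-form i dz /\ d(zbar) + i dw /\ d(wbar); recall that
   i dz /\ d(zbar) = 2 dx /\ dy for z = x + iy. *)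
Definition beta_form : form2 := fun p u v =>
  2 * (u.1.1 * v.1.2 - u.1.2 * v.1.1) + 2 * (u.2.1 * v.2.2 - u.2.2 * v.2.1).

(* The (1,1)-form i d dbar f: writing H for the real Hessian of f at p, its
   value on (u, v) is (H (i u, v) - H (u, i v)) / 2.  In one variable, on the
   pair (1, i), this is half the Laplacian.  The operator dd^c is a nonzero
   constant multiple of i d dbar, whatever the normalization. *)
Definition iddbar (f : C2 R -> R) : form2 := fun p u v =>
  2^-1 * ('D_(c2scale (ci R) u) ('D_v f) p - 'D_u ('D_(c2scale (ci R) v) f) p).

End AmbientCalculus.

Section Foliation.
Variables (R : realType) (lambda : R).

Definition vfield (p : C2 R) : C2 R := (p.1, lambda *: p.2).

(* zeta |-> leaf_flow zeta p = (e^(i zeta) z, e^(i lambda zeta) w) parametrizes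
   the leaf (of C^2 minus 0) through p = (z, w): it integrates i * vfield, is
   the parametrization of L_alpha if p = (1, alpha), and that of a separatrix
   if exactly one of z and w vanishes. *)
Definition leaf_flow (zeta : C1 R) (p : C2 R) : C2 R :=
  (cmul (cexp (cmul (ci R) zeta)) p.1,
   cmul (cexp (lambda *: cmul (ci R) zeta)) p.2).

(* Derivatives along the leaves in the coordinate zeta = x + iy: in the
   direction y if b is true, and x otherwise. *)
Definition leaf_dir (b : bool) (t : R) : C1 R := if b then (0, t) else (t, 0).

Definition along_leaf (b : bool) (f : C2 R -> R) (p : C2 R) (t : R) : R :=
  f (leaf_flow (leaf_dir b t) p).

Definition leaf_derive (b : bool) (f : C2 R -> R) (p : C2 R) : R :=
  derive1 (along_leaf b f p) 0.

Fixpoint iter_leaf_derive (bs : seq bool) (f : C2 R -> R) : C2 R -> R :=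
  if bs is b :: bs' then leaf_derive b (iter_leaf_derive bs' f) else f.

(* Leafwise smooth and transversally continuous: all the leafwise derivatives
   exist and are continuous as functions on the ambient space (that is, in
   flow boxes, jointly in the leaf and the transversal variables). *)
Definition leafwise_smooth (f : C2 R -> R) : Prop :=
  forall bs : seq bool, continuous (iter_leaf_derive bs f) /\
    forall p b, derivable (along_leaf b (iter_leaf_derive bs f) p) 0 1.

(* The test functions, extended by 0 to C^2. *)
Definition test_fun (f : C2 R -> R) : Prop :=
  leafwise_smooth f /\ compactly_supported_in (@punctured_bidisc R) f.

(* On a parametrized leaf zeta is defined up to an additive constant, hence
   dx /\ dy = (i / 2) dzeta /\ d(zetabar) is a nowhere vanishing smooth
   leafwise (1,1)-form.  A leafwise (1,1)-form g dx /\ dy is represented by its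
   coefficient g; it is positive iff g is nonnegative. *)
Definition leaf_form : Type := C2 R -> R.

Definition test_form (g : leaf_form) : Prop := test_fun g.

Definition positive_form (g : leaf_form) : Prop := forall p, 0 <= g p.

Definition leaf_iddbar (f : C2 R -> R) : leaf_form := fun p =>
  2^-1 * (iter_leaf_derive [:: false; false] f p
          + iter_leaf_derive [:: true; true] f p).

(* Restriction of an ambient 2-form to the leaves, by evaluation on the
   tangent vectors d/dx = i * vfield and d/dy = i * (i * vfield). *)
Definition leaf_restrict (Om : form2 R) : leaf_form := fun p =>
  let dx := c2scale (ci R) (vfield p) in Om p dx (c2scale (ci R) dx).

Definition mul_form (chi : C2 R -> R) (g : leaf_form) : leaf_form :=
  fun p => chi p * g p.

(* Continuity for the usual (inductive limit) topology of test forms. *)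
Definition continuous_on_test_forms (T : leaf_form -> R) : Prop :=
  forall K : set (C2 R), compact K -> K `<=` @punctured_bidisc R ->
  exists (N : nat) (c : R), forall (g : leaf_form) (M : R),
    test_form g -> (forall p, ~ K p -> g p = 0) ->
    (forall bs p, (size bs <= N)%N -> `|iter_leaf_derive bs g p| <= M) ->
    `|T g| <= c * M.

(* A functional on all coefficients, of which only the values on test forms
   are meaningful. *)
Record directed_harmonic_current (T : leaf_form -> R) : Prop := {
  dhc_linear : forall (a : R) (g h : leaf_form), test_form g -> test_form h ->
    T (fun p => a * g p + h p) = a * T g + T h ;
  dhc_continuous : continuous_on_test_forms T ;
  dhc_harmonic : forall f, test_fun f -> T (leaf_iddbar f) = 0 ;
  dhc_positive : forall g, test_form g -> positive_form g -> 0 <= T g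
}.

(* mass T A is the value at A of the Radon measure T /\ beta on the punctured
   bidisc that the Riesz representation theorem associates with the positive
   functional chi |-> T (chi beta): a supremum over cutoffs for an open set,
   extended to arbitrary sets by outer regularity. *)
Definition open_mass (T : leaf_form -> R) (U : set (C2 R)) : \bar R :=
  ereal_sup [set (T (mul_form chi (leaf_restrict (@beta_form R))))%:E | chi in
    [set chi | [/\ test_fun chi, forall p, 0 <= chi p <= 1 &
                   compactly_supported_in (U `&` @punctured_bidisc R) chi]]].

Definition mass (T : leaf_form -> R) (A : set (C2 R)) : \bar R :=
  ereal_inf [set open_mass T U | U in
    [set U | open U /\ A `&` @punctured_bidisc R `<=` U]].

Definition no_mass_on_separatrices (T : leaf_form -> R) : Prop :=
  mass T [set p | p.1 = 0] = 0%E /\ mass T [set p | p.2 = 0] = 0%E.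

Definition origin_cutoffs (chi : nat -> C2 R -> R) : Prop :=
  [/\ forall n, smooth (chi n), forall n p, 0 <= chi n p <= 1,
      forall n, \forall p \near (0 : C2 R), chi n p = 0 &
      forall r, 0 < r -> \forall n \near \oo, forall p, r <= `|p| ->
        chi n p = 1].

(* The trivial extension of T by 0 across the origin takes the value l on the
   smooth (1,1)-form Om, compactly supported in the bidisc.  When T has finite
   mass the limit exists and does not depend on the cutoffs. *)
Definition trivial_extension_value (T : leaf_form -> R) (Om : form2 R) (l : R)
    : Prop :=
  forall chi, origin_cutoffs chi ->
    T (mul_form (chi n) (leaf_restrict Om)) @[n --> \oo] --> l.

Definition trivial_extension_ddc_closed (T : leaf_form -> R) : Prop :=
  forall f : C2 R -> R, smooth f -> compactly_supported_in (@bidisc R) f ->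
    trivial_extension_value T (iddbar f) 0.

(* The k-th iterate (z, w) |-> (z, e^(2 k pi i lambda) w) of the generator of
   the monodromy.  It commutes with leaf_flow, hence preserves dx /\ dy, and
   the pullback of a leafwise form is the composition of its coefficient. *)
Definition monodromy (k : nat) (p : C2 R) : C2 R :=
  (p.1, cmul (cexp (0, 2 * k%:R * pi * lambda)) p.2).

Definition monodromy_invariant (k : nat) (T : leaf_form -> R) : Prop :=
  forall g, test_form g -> T (g \o monodromy k) = T g.

Definition periodic_current (T : leaf_form -> R) : Prop :=
  exists k : nat, (0 < k)%N /\ monodromy_invariant k T.

Definition lelong_number (T : leaf_form -> R) : \bar R :=
  limf_esup (fun r : R => ((pi * r ^+ 2)^-1)%:E * mass T (polydisc r))%E
    (at_right (0 : R)).

End Foliation.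

(* Main.v *)
(* It is enough to test T on functions of |z| and |w|.  On them the leafwise
   Laplacian is the second derivative in y = Im zeta; |z|^2 and |w|^2 are
   eigenfunctions of the derivative in y, and |z|^(-2 lambda) |w|^2 is constant
   on the leaves.  With s = r^2, the function
     ln (s / ((s + |z|^2) (s + |w|^2)))
   is concave in y, its second derivative is at most
   - (|z|^2 + lambda^2 |w|^2) / s on the bidisc of radius r, and on the leaves
   meeting this bidisc it is bounded near the boundary of the unit bidisc,
   uniformly in r.  Cutting it off near that boundary and applying harmonicity
   bounds the mass of T on the bidisc of radius r by C r^2 times the mass, near
   the boundary of the unit bidisc, of the leaves with
   |z|^(-2 lambda) |w|^2 <= 2 r^(2 - 2 lambda).  The latter tends to 0 with r,
   because these leaves shrink to the separatrices, which carry no mass. *)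

Require Import Defs.
From mathcomp Require Import all_boot all_order all_algebra.
From mathcomp Require Import all_classical all_reals all_analysis.
From mathcomp Require Import ring lra.

Import Order.TTheory GRing.Theory Num.Theory.
Import numFieldNormedType.Exports.

Set Implicit Arguments.
Unset Strict Implicit.
Unset Printing Implicit Defensive.

Local Open Scope classical_set_scope.
Local Open Scope ring_scope.

(** * Smooth functions of one real variable *)

Section SmoothOneVariable.
Variable R : realType.
Implicit Types (D : R -> Prop) (f g : R -> R).

(* Smoothness on D is witnessed by any family closed under differentiation, so
   that no iterated derivative has to be computed. *)
Definition smooth_on D g := exists2 S : (R -> R) -> Prop, S g &
  forall f, S f -> exists2 f', S f' & forall x, D x -> is_derive x 1 f (f' x).

Lemma smooth_on_derive D g : smooth_on D g ->
  exists2 g', smooth_on D g' & forall x, D x -> is_derive x 1 g (g' x).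
Proof.
move=> [S Sg SD]; have [g' Sg' g'E] := SD _ Sg.
by exists g' => //; exists S.
Qed.

Lemma is_derive_continuous f (x d : R) : is_derive x 1 f d -> {for x, continuous f}.
Proof. by move=> fd; apply/differentiable_continuous/derivable1_diffP. Qed.

Lemma is_derive1D f g (x a b : R) : is_derive x 1 f a -> is_derive x 1 g b ->
  is_derive x 1 (fun y => f y + g y) (a + b).
Proof. exact: is_deriveD. Qed.

Lemma is_derive1M f g (x a b : R) : is_derive x 1 f a -> is_derive x 1 g b ->
  is_derive x 1 (fun y => f y * g y) (a * g x + f x * b).
Proof.
move=> fa gb; apply: is_derive_eq (is_deriveM fa gb) _.
by rewrite /GRing.scale/= addrC; congr (_ + _); rewrite mulrC.
Qed.

Lemma is_derive1_cst (c x : R) : is_derive x 1 (fun=> c) 0.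
Proof. exact: is_derive_cst. Qed.

Lemma is_derive1_inv_exp n (x : R) : x != 0 ->
  is_derive x 1 (fun y => y ^- n) (- n%:R * x ^- n.+1).
Proof.
move=> xn; have h : is_derive x 1 (fun y : R => y ^+ n) (n%:R * x ^+ n.-1).
  have := is_deriveX n (is_derive_id x 1).
  by rewrite exprfctE /GRing.scale/= mulr1.
apply: is_derive_eq (@is_deriveV R (fun y => y ^+ n) x _ 1 (expf_neq0 n xn) h) _.
rewrite /GRing.scale/=.
case: n {h} => [|n]; first by rewrite !(mulr0, mul0r, oppr0).
by rewrite /= !exprS; field; rewrite ?expf_neq0 ?xn.
Qed.

(** The powers [x ^- n] are included because differentiating [expR (- x^-1)] produces them; [flat 0]
    is the usual function vanishing to infinite order at 0. *)
Definition flat (n : nat) (x : R) := if 0 < x then x ^- n * expR (- x^-1) else 0.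

Lemma flat_ge0 n x : 0 <= flat n x.
Proof.
rewrite /flat; case: ifP => // x0.
by rewrite mulr_ge0 ?expR_ge0// invr_ge0 exprn_ge0// ltW.
Qed.

(** The term of degree n+1 of the exponential series of [x^-1] beats [x ^- n] by one factor [x].
    This linear bound settles the derivative at 0. *)
Lemma flat_le n x : 0 <= x -> flat n x <= (n.+1)`!%:R * x.
Proof.
move=> x0; rewrite /flat; case: ifP => xp; last by rewrite mulr_ge0.
have i0 : 0 <= x^-1 by rewrite invr_ge0.
have := @expR_ge1Dxn R x^-1 n i0.
move=> /(le_trans (ler_wpDl ler01 (lexx _))) H.
rewrite expRN -exprVn ler_pdivrMr ?expR_gt0//.
have fp : 0 < (n.+1)`!%:R :> R by rewrite ltr0n fact_gt0.
move: H; rewrite ler_pdivrMr// => H.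
rewrite mulrAC [_ * expR _]mulrC -ler_pdivrMr//.
by rewrite -exprSr.
Qed.

Lemma flat_is_derive n (x : R) :
  is_derive x 1 (flat n) (flat n.+2 x - n%:R * flat n.+1 x).
Proof.
have [x0|x0|->] := ltgtP x 0.
- rewrite [flat n.+2 _]/flat [flat n.+1 _]/flat !(lt_gtF x0) mulr0 subr0.
  apply: (@near_eq_is_derive _ _ _ (cst 0)).
    near=> y; suff y0 : y < 0 by rewrite /flat (lt_gtF y0).
    by near: y; exact: lt_nbhsl.
- apply: (@near_eq_is_derive R R R (fun y : R => y ^- n * expR (- y^-1)) (flat n) x).
    near=> y; suff : 0 < y by rewrite /flat => ->.
    by near: y; exact: lt_nbhsr.
  have xn : x != 0 by rewrite gt_eqF.
  have h4 : is_derive x 1 (fun y : R => - y^-1) (- (- 1%:R * x ^- 2)).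
    exact: is_deriveN (is_derive1_inv_exp 1 xn).
  have h5 : is_derive x 1 (fun y : R => expR (- y^-1))
      (expR (- x^-1) * (- (- 1%:R * x ^- 2))).
    exact: (@is_derive1_comp R expR (fun y => - y^-1) x _ _ (is_derive_expR _) h4).
  have h6 := is_derive1M (is_derive1_inv_exp n xn) h5.
  apply: is_derive_eq h6 _.
  rewrite /flat x0 !exprS; field; rewrite ?expf_neq0 ?xn//.
- rewrite /flat !ltxx mulr0 subr0.
  have cv : h^-1 *: (flat n (h *: 1 + 0) - flat n 0) @[h --> 0^'] --> (0 : R).
    apply/cvgr0Pnorm_lt => e e0; near=> h.
    have he : `|h| < e / (n.+2)`!%:R.
      by near: h; apply: dnbhs0_lt; rewrite divr_gt0// ltr0n fact_gt0.
    rewrite /GRing.scale/= mulr1 addr0 /flat ltxx subr0.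
    case: ifP => h0; last by rewrite mulr0 normr0.
    (* The difference quotient at 0 is [flat n.+1 h], so the linear bound forces it to 0. *)
    rewrite mulrA -invfM -exprS.
    have /= := @flat_le n.+1 h (ltW h0); rewrite /flat h0 => H.
    rewrite ger0_norm ?mulr_ge0 ?expR_ge0 ?invr_ge0 ?exprn_ge0 ?ltW//.
    apply: le_lt_trans H _; rewrite mulrC -ltr_pdivlMr ?ltr0n ?fact_gt0//.
    by rewrite gtr0_norm in he.
  by split; [exact: cvgP cv|exact: cvg_lim cv].
Unshelve. all: by end_near. Qed.

(** A family stable under differentiation, witnessing the smoothness of [flat 0]. *)
Inductive flat_span : (R -> R) -> Prop :=
| flat_span_base n : flat_span (flat n)
| flat_span_lin a f g : flat_span f -> flat_span g ->
    flat_span (fun x => a * f x + g x).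

Lemma smooth_flat D : smooth_on D (flat 0).
Proof.
exists flat_span; first exact: flat_span_base.
move=> f; elim=> [n|a {}f g _ [f' Sf' f'E] _ [g' Sg' g'E]].
  exists (fun x => - n%:R * flat n.+1 x + flat n.+2 x).
    by apply: flat_span_lin; exact: flat_span_base.
  by move=> x _; apply: is_derive_eq (flat_is_derive n x) _; rewrite mulNr addrC.
exists (fun x => a * f' x + g' x); first exact: flat_span_lin.
move=> x Dx; have := f'E x Dx; have := g'E x Dx => hg hf.
by apply: is_derive_eq (is_derive1D (is_derive1M
  (is_derive1_cst a x) hf) hg) _; rewrite mul0r add0r.
Qed.

(** One family stable under differentiation on the positive half-line serves both [ln] and the
    inverse. *)
Inductive inv_pow : (R -> R) -> Prop :=
| inv_pow_ln : inv_pow (@ln R)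
| inv_pow_base a n : inv_pow (fun x => a * x ^- n).

Lemma inv_pow_derive f : inv_pow f ->
  exists2 f', inv_pow f' & forall x : R, 0 < x -> is_derive x 1 f (f' x).
Proof.
case=> [|a n].
  exists (fun x => 1 * x ^- 1); first exact: inv_pow_base.
  by move=> x x0; rewrite mul1r expr1; exact: is_derive1_ln.
exists (fun x => - (a * n%:R) * x ^- n.+1); first exact: inv_pow_base.
move=> x x0; have xn : x != 0 by rewrite gt_eqF.
apply: is_derive_eq (is_derive1M (is_derive1_cst a x)
  (is_derive1_inv_exp n xn)) _.
by rewrite mul0r add0r mulrA mulrN.
Qed.

Lemma smooth_ln : smooth_on (fun x : R => 0 < x) (@ln R).
Proof. by exists inv_pow => //; [exact: inv_pow_ln|exact: inv_pow_derive]. Qed.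

Lemma smooth_inv : smooth_on (fun x : R => 0 < x) (fun x => x^-1).
Proof.
exists inv_pow; last exact: inv_pow_derive.
rewrite (_ : (fun x => x^-1) = fun x => 1 * x ^- 1); first exact: inv_pow_base.
by apply/funext => x; rewrite mul1r.
Qed.

End SmoothOneVariable.

(** * Derivatives along the leaves and leafwise smoothness *)

Section LeafwiseCalculus.
Variables (R : realType) (lambda : R).
Implicit Types (f g : C2 R -> R) (p : C2 R) (b : bool).

Definition sqnorm (a : C1 R) : R := a.1 ^+ 2 + a.2 ^+ 2.

Lemma sqnorm_ge0 a : 0 <= sqnorm a.
Proof. by rewrite addr_ge0// sqr_ge0. Qed.

Lemma continuous_sqnorm1 : continuous (fun p : C2 R => sqnorm p.1).
Proof.
move=> p; rewrite /sqnorm; apply: cvgD; apply: cvgM; 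
  by apply: (@continuous_comp _ _ _ (@fst (C1 R) (C1 R)));
  [exact: cvg_fst|first [exact: cvg_fst|exact: cvg_snd]].
Qed.

Lemma continuous_sqnorm2 : continuous (fun p : C2 R => sqnorm p.2).
Proof.
move=> p; rewrite /sqnorm; apply: cvgD; apply: cvgM; 
  by apply: (@continuous_comp _ _ _ (@snd (C1 R) (C1 R)));
  [exact: cvg_snd|first [exact: cvg_fst|exact: cvg_snd]].
Qed.

Lemma sqnorm_cmul a c : sqnorm (cmul a c) = sqnorm a * sqnorm c.
Proof. by rewrite /sqnorm /cmul/=; ring. Qed.

Lemma sqnorm_cexp a : sqnorm (cexp a) = expR (2 * a.1).
Proof.
rewrite /sqnorm /cexp/= !exprMn -mulrDr cos2Dsin2 mulr1 expr2 -expRD.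
by congr expR; ring.
Qed.

(** The squared modulus of e^(i zeta) is e^(-2 Im zeta), so only the direction y changes the
    moduli. *)
Lemma sqnorm_flow1 b t p :
  sqnorm (leaf_flow lambda (leaf_dir b t) p).1 =
    expR (if b then - 2 * t else 0) * sqnorm p.1.
Proof.
rewrite /leaf_flow/= sqnorm_cmul sqnorm_cexp; congr (expR _ * _).
by case: b; rewrite /cmul/ci/leaf_dir/=; ring.
Qed.

Lemma sqnorm_flow2 b t p :
  sqnorm (leaf_flow lambda (leaf_dir b t) p).2 =
    expR (if b then - 2 * lambda * t else 0) * sqnorm p.2.
Proof.
rewrite /leaf_flow/= sqnorm_cmul sqnorm_cexp; congr (expR _ * _).
by case: b; rewrite /cmul/ci/leaf_dir /GRing.scale/= /GRing.scale/=; ring.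
Qed.

Lemma leaf_flow0 b p : leaf_flow lambda (leaf_dir b 0) p = p.
Proof.
rewrite /leaf_flow /cexp /cmul /leaf_dir /ci /GRing.scale/=.
by case: b; rewrite /= /GRing.scale/=
    !(mulr0, mul0r, subr0, addr0, oppr0, expR0, cos0, sin0, mul1r, mulr1, add0r);
  case: p => -[? ?] [? ?].
Qed.

Definition leaf_is_derive b f g := forall p, is_derive (0 : R) 1 (along_leaf lambda b f p) (g p).

Lemma leaf_is_derive_eq b f g : leaf_is_derive b f g -> leaf_derive lambda b f = g.
Proof.
by move=> H; apply/funext => p; have Hp := H p; rewrite /leaf_derive derive1E derive_val.
Qed.

Lemma leafwise_smooth_is_derive b f : leafwise_smooth lambda f ->
  leaf_is_derive b f (leaf_derive lambda b f).
Proof.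
move=> /(_ [::])[_ /= fd] p; rewrite /leaf_derive derive1E.
exact: derivableP.
Qed.

Lemma iter_leaf_derive_rcons bs b f :
  iter_leaf_derive lambda (rcons bs b) f = iter_leaf_derive lambda bs (leaf_derive lambda b f).
Proof. by elim: bs => //= c bs ->. Qed.

Lemma leafwise_smooth_derive b f : leafwise_smooth lambda f ->
  leafwise_smooth lambda (leaf_derive lambda b f).
Proof. by move=> fs bs; rewrite -iter_leaf_derive_rcons; exact: fs. Qed.

(** Coinduction: a class of continuous functions stable under both leaf derivatives contains all
    iterated derivatives of its members, so none of them has to be computed. *)
Lemma leafwise_smooth_coind (S : (C2 R -> R) -> Prop) :
  (forall f, S f -> continuous f /\ forall b, exists2 g, S g & leaf_is_derive b f g) ->
  forall f, S f -> leafwise_smooth lambda f.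
Proof.
move=> SP f Sf bs.
have Sb : S (iter_leaf_derive lambda bs f).
  elim: bs => //= b bs /SP[_ /(_ b)[g Sg /leaf_is_derive_eq ->]]//.
have [c d] := SP _ Sb; split=> // p b; have [g _ gd] := d b.
by case: (gd p).
Qed.

Lemma leaf_is_deriveD b f g f' g' : leaf_is_derive b f f' -> leaf_is_derive b g g' ->
  leaf_is_derive b (fun p => f p + g p) (fun p => f' p + g' p).
Proof. by move=> hf hg p; exact: (is_derive1D (hf p) (hg p)). Qed.

Lemma leaf_is_deriveM b f g f' g' : leaf_is_derive b f f' -> leaf_is_derive b g g' ->
  leaf_is_derive b (fun p => f p * g p) (fun p => f' p * g p + f p * g' p).
Proof.
move=> hf hg p; have := is_derive1M (hf p) (hg p).
by rewrite /along_leaf leaf_flow0.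
Qed.

Lemma leaf_is_derive_comp D (h h' : R -> R) b f f' :
  (forall x : R, D x -> is_derive x 1 h (h' x)) -> (forall p, D (f p)) ->
  leaf_is_derive b f f' ->
  leaf_is_derive b (fun p => h (f p)) (fun p => h' (f p) * f' p).
Proof.
move=> hh fD hf p; apply: (@is_derive1_comp R h (along_leaf lambda b f p)) => //.
by rewrite /along_leaf leaf_flow0; exact: hh.
Qed.

Lemma leaf_is_derive_cst b (c : R) : leaf_is_derive b (fun=> c) (fun=> 0).
Proof. by move=> p; exact: is_derive1_cst. Qed.

(** The product and chain rules only produce terms of these shapes, so this class is stable under
    leaf derivatives. *)
Inductive leaf_class : (C2 R -> R) -> Prop :=
| leaf_class_base f : leafwise_smooth lambda f -> leaf_class f
| leaf_class_add f g : leaf_class f -> leaf_class g ->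
    leaf_class (fun p => f p + g p)
| leaf_class_mul f g : leaf_class f -> leaf_class g ->
    leaf_class (fun p => f p * g p)
| leaf_class_comp D h f : smooth_on D h -> (forall p, D (f p)) ->
    leaf_class f -> leaf_class (fun p => h (f p)).

Lemma leaf_class_smooth f : leaf_class f -> leafwise_smooth lambda f.
Proof.
apply: (leafwise_smooth_coind (S := leaf_class)) => {}f.
elim=> {f} [f fs|f g _ [cf df] _ [cg dg]|f g lf [cf df] lg [cg dg]|D h f hD fD lf [cf df]].
- split; first exact: (fs [::]).1.
  move=> b; exists (leaf_derive lambda b f).
    exact/leaf_class_base/leafwise_smooth_derive.
  exact: leafwise_smooth_is_derive.
- split; first by move=> p; apply: cvgD; [exact: cf|exact: cg].
  move=> b; have [f' lf' hf] := df b; have [g' lg' hg] := dg b.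
  by exists (fun p => f' p + g' p); [exact: leaf_class_add|exact: leaf_is_deriveD].
- split; first by move=> p; apply: cvgM; [exact: cf|exact: cg].
  move=> b; have [f' lf' hf] := df b; have [g' lg' hg] := dg b.
  exists (fun p => f' p * g p + f p * g' p); last exact: leaf_is_deriveM.
  by apply: leaf_class_add; exact: leaf_class_mul.
- have [h' hD' hh'] := smooth_on_derive hD; split.
    move=> p; apply: continuous_comp; first exact: cf.
    exact: is_derive_continuous (hh' _ (fD p)).
  move=> b; have [f' lf' hf] := df b.
  exists (fun p => h' (f p) * f' p); last exact: leaf_is_derive_comp hh' fD hf.
  by apply: leaf_class_mul => //; exact: leaf_class_comp hD' fD lf.
Qed.

Lemma leafwise_smoothD f g : leafwise_smooth lambda f -> leafwise_smooth lambda g ->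
  leafwise_smooth lambda (fun p => f p + g p).
Proof. by move=> fs gs; apply/leaf_class_smooth/leaf_class_add; exact: leaf_class_base. Qed.

Lemma leafwise_smoothM f g : leafwise_smooth lambda f -> leafwise_smooth lambda g ->
  leafwise_smooth lambda (fun p => f p * g p).
Proof. by move=> fs gs; apply/leaf_class_smooth/leaf_class_mul; exact: leaf_class_base. Qed.

Lemma leafwise_smooth_comp D (h : R -> R) f : smooth_on D h -> (forall p, D (f p)) ->
  leafwise_smooth lambda f -> leafwise_smooth lambda (fun p => h (f p)).
Proof.
by move=> hD fD fs; apply/leaf_class_smooth/(leaf_class_comp hD fD); exact: leaf_class_base.
Qed.

Lemma leafwise_constant_is_derive f :
  (forall b t p, f (leaf_flow lambda (leaf_dir b t) p) = f p) ->
  forall b, leaf_is_derive b f (fun=> 0).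
Proof.
move=> fc b p; rewrite [along_leaf _ _ _ _](_ : _ = fun=> f p); first exact: is_derive1_cst.
by apply/funext => t; rewrite /along_leaf fc.
Qed.

(** All leaf derivatives vanish, so continuity is the only regularity required. Cutoffs transverse
    to the leaves can thus be merely continuous. *)
Lemma leafwise_constant_smooth f : continuous f ->
  (forall b t p, f (leaf_flow lambda (leaf_dir b t) p) = f p) -> leafwise_smooth lambda f.
Proof.
move=> cf fc.
apply: (leafwise_smooth_coind (S := fun g => continuous g /\
  forall b t p, g (leaf_flow lambda (leaf_dir b t) p) = g p)) => // g [cg gc].
split=> // b; exists (fun=> 0); last exact: leafwise_constant_is_derive.
by split => // p; exact: cvg_cst.
Qed.

Lemma leafwise_smooth_cst (c : R) : leafwise_smooth lambda (fun=> c).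
Proof. by apply: leafwise_constant_smooth => // p; exact: cvg_cst. Qed.

Lemma leafwise_smoothZ (c : R) f : leafwise_smooth lambda f ->
  leafwise_smooth lambda (fun p => c * f p).
Proof. exact/leafwise_smoothM/leafwise_smooth_cst. Qed.

Lemma leafwise_smoothB f g : leafwise_smooth lambda f -> leafwise_smooth lambda g ->
  leafwise_smooth lambda (fun p => f p - g p).
Proof.
move=> fs gs; apply: (leafwise_smoothD fs).
rewrite (_ : (fun p => - g p) = fun p => -1 * g p); first exact: leafwise_smoothZ.
by apply/funext => p; rewrite mulN1r.
Qed.

Lemma is_derive_expRM (c x : R) : is_derive (0 : R) 1 (fun t => expR (c * t) * x) (c * x).
Proof.
have h : is_derive (0 : R) 1 (fun t => c * t) c.
  apply: is_derive_eq (is_derive1M (is_derive1_cst c 0) (is_derive_id (0 : R) 1)) _.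
  by rewrite mul0r add0r mulr1.
have h2 := @is_derive1_comp R expR (fun t => c * t) 0 _ _ (is_derive_expR _) h.
apply: is_derive_eq (is_derive1M h2 (is_derive1_cst x 0)) _.
by rewrite !mulr0 addr0 expR0 mul1r.
Qed.

Lemma sqnorm1_is_derive b : leaf_is_derive b (fun p => sqnorm p.1)
  (fun p => (if b then - 2 else 0) * sqnorm p.1).
Proof.
move=> p; rewrite [along_leaf _ _ _ _](_ : _ =
  fun t => expR ((if b then - 2 else 0) * t) * sqnorm p.1).
  exact: is_derive_expRM.
by apply/funext => t; rewrite /along_leaf sqnorm_flow1; case: b; rewrite ?mul0r.
Qed.

Lemma sqnorm2_is_derive b : leaf_is_derive b (fun p => sqnorm p.2)
  (fun p => (if b then - 2 * lambda else 0) * sqnorm p.2).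
Proof.
move=> p; rewrite [along_leaf _ _ _ _](_ : _ =
  fun t => expR ((if b then - 2 * lambda else 0) * t) * sqnorm p.2).
  exact: is_derive_expRM.
by apply/funext => t; rewrite /along_leaf sqnorm_flow2; case: b; rewrite ?mul0r.
Qed.

(** The scalar multiples of a common eigenfunction are stable under both leaf derivatives. *)
Lemma leafwise_smooth_eigen f (c : bool -> R) : continuous f ->
  (forall b, leaf_is_derive b f (fun p => c b * f p)) -> leafwise_smooth lambda f.
Proof.
move=> cf fd.
apply: (leafwise_smooth_coind (S := fun g => exists a, g = fun p => a * f p)); last first.
  by exists 1; apply/funext => p; rewrite mul1r.
move=> _ [a ->]; split; first by move=> p; apply: cvgM; [exact: cvg_cst|exact: cf].
move=> b; exists (fun p => 0 * f p + a * (c b * f p)).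
  by exists (a * c b); apply/funext => p; rewrite mul0r add0r mulrA.
exact: leaf_is_deriveM (leaf_is_derive_cst b a) (fd b).
Qed.

Lemma leafwise_smooth_sqnorm1 : leafwise_smooth lambda (fun p => sqnorm p.1).
Proof. exact: leafwise_smooth_eigen continuous_sqnorm1 sqnorm1_is_derive. Qed.

Lemma leafwise_smooth_sqnorm2 : leafwise_smooth lambda (fun p => sqnorm p.2).
Proof. exact: leafwise_smooth_eigen continuous_sqnorm2 sqnorm2_is_derive. Qed.

End LeafwiseCalculus.

(** * Bounds on compact sets, and cutoffs of one variable *)

Section Compactness.
Variable R : realType.

Lemma compact_positive_lower_bound (X : topologicalType) (K : set X) (f : X -> R) :
  compact K -> continuous f -> (forall x, K x -> 0 < f x) ->
  exists2 c, 0 < c & forall x, K x -> c <= f x.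
Proof.
move=> cK cf f0; have [->|/set0P K0] := eqVneq K set0; first by exists 1.
have [x xK fx] := compact_EVT_min K0 cK (continuous_subspaceT cf).
exists (f x); first exact/f0/set_mem.
by move=> y Ky; apply/fx/mem_set.
Qed.

Lemma compact_upper_bound (X : topologicalType) (K : set X) (f : X -> R) :
  compact K -> continuous f -> exists2 M, 0 < M & forall x, K x -> f x <= M.
Proof.
move=> cK cf; have [->|/set0P K0] := eqVneq K set0; first by exists 1.
have [x xK fx] := compact_EVT_max K0 cK (continuous_subspaceT cf).
exists (Num.max 1 (f x)); first by rewrite lt_max ltr01.
by move=> y Ky; rewrite le_max; apply/orP; right; apply/fx/mem_set.
Qed.

(** On the compact set of points of [K] outside [U], [f] has a positive lower bound; half of it is a
    level that these points do not reach. *)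
Lemma compact_sublevel (X : topologicalType) (K U : set X) (f : X -> R) :
  compact K -> open U -> continuous f -> (forall x, 0 <= f x) ->
  (forall x, K x -> f x = 0 -> U x) ->
  exists2 d, 0 < d & forall x, K x -> f x <= d -> U x.
Proof.
move=> cK oU cf f0 KU.
have cKU : compact (K `&` ~` U).
  by apply: compact_closedI => //; exact: open_closedC.
have [x [Kx Ux]|c c0 cP] := compact_positive_lower_bound cKU cf.
  by rewrite lt_neqAle f0 andbT eq_sym; apply/eqP => /(KU _ Kx).
exists (c / 2); first by rewrite divr_gt0.
move=> x Kx fx; apply: contrapT => Ux.
by have := le_trans (cP x (conj Kx Ux)) fx; lra.
Qed.

Lemma closed_sublevel (X : topologicalType) (f : X -> R) c :
  continuous f -> closed [set x | f x <= c].
Proof. by move=> cf; have /continuous_closedP/(_ _ (@closed_le R c)) := cf. Qed.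

Lemma closed_superlevel (X : topologicalType) (f : X -> R) c :
  continuous f -> closed [set x | c <= f x].
Proof. by move=> cf; have /continuous_closedP/(_ _ (@closed_ge R c)) := cf. Qed.

Lemma compact_sqnorm_le1 (A : set (C2 R)) : closed A ->
  (forall p, A p -> sqnorm p.1 <= 1 /\ sqnorm p.2 <= 1) -> compact A.
Proof.
move=> cA hA; pose I : set R := `[-1, 1]%classic.
have cI : compact I by exact: segment_compact.
apply: (subclosed_compact cA (compact_setX (compact_setX cI cI) (compact_setX cI cI))).
move=> [[a b] [c d]] /hA[]; rewrite /sqnorm/= => h1 h2.
rewrite /I /=; split; split => /=; rewrite in_itv/=; apply/andP; split; nra.
Qed.

Lemma flat0_gt0 (x : R) : 0 < x -> 0 < flat 0 x.
Proof. by move=> x0; rewrite /flat x0 expr0 invr1 mul1r expR_gt0. Qed.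

Lemma flat_le0 n (x : R) : x <= 0 -> flat n x = 0.
Proof. by rewrite /flat leNgt => /negbTE ->. Qed.

(** It descends linearly from 1 at [c] to 0 at [2 * c]. Continuity suffices, since it is applied to
    the first integral, which is constant on the leaves. *)
Definition ramp (c x : R) : R := Num.min 1 (Num.max 0 (2 - c^-1 * x)).

Lemma continuous_ramp c : continuous (ramp c).
Proof.
move=> x; apply: (@continuous_min R R (fun=> 1) (fun x => Num.max 0 (2 - c^-1 * x))).
  exact: cvg_cst.
apply: (@continuous_max R R (fun=> 0) (fun x => 2 - c^-1 * x)).
  exact: cvg_cst.
apply: cvgB; first exact: cvg_cst.
by apply: cvgM; [exact: cvg_cst|exact: cvg_id].
Qed.

Lemma ramp_ge0 c x : 0 <= ramp c x.
Proof. by rewrite /ramp le_min ler01 le_max lexx. Qed.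

Lemma ramp_le1 c x : ramp c x <= 1.
Proof. by rewrite /ramp ge_min lexx. Qed.

Lemma ramp_eq1 c x : 0 < c -> x <= c -> ramp c x = 1.
Proof.
move=> c0 xc; apply/min_idPl; rewrite le_max; apply/orP; right.
have : c^-1 * x <= 1 by rewrite ler_pdivrMl ?mulr1.
by lra.
Qed.

Lemma ramp_eq0 c x : 0 < c -> 2 * c <= x -> ramp c x = 0.
Proof.
move=> c0 xc; rewrite /ramp (max_idPl _) ?min_r ?ler01//.
have : 2 <= c^-1 * x by rewrite ler_pdivlMl// mulrC.
by lra.
Qed.

End Compactness.

(** * The first integral of the foliation *)

Section FirstIntegral.
Variables (R : realType) (lambda : R).
Hypothesis hlambda : lambda < 0.
Implicit Types p : C2 R.

(** This is |z|^(-2 lambda) |w|^2. Since [lambda < 0] the exponent is positive, so the function is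
    continuous and vanishes exactly on the separatrices and at the origin. *)
Definition first_integral p : R := sqnorm p.1 `^ (- lambda) * sqnorm p.2.

Lemma first_integral_ge0 p : 0 <= first_integral p.
Proof. by rewrite mulr_ge0 ?powR_ge0 ?sqnorm_ge0. Qed.

(** Where z is nonzero the power is an exponential of a logarithm. Where z = 0 its value is 0,
    because [a] is nonzero, and [x <= e]^ a^-1[gives]x [^ a <= e]. *)
Lemma continuous_powR_sqnorm1 a : 0 < a -> continuous (fun p => sqnorm p.1 `^ a).
Proof.
move=> a0 p; have c1 := @continuous_sqnorm1 R.
have [P0|P0] := eqVneq (sqnorm p.1) 0; last first.
  have Pp : 0 < sqnorm p.1 by rewrite lt_neqAle eq_sym P0 sqnorm_ge0.
  apply: (@cvg_trans _ ((fun q => expR (a * ln (sqnorm q.1))) @ p)).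
    apply: near_eq_cvg; near=> q; rewrite /powR gt_eqF//.
    near: q; have := c1 p; move=> /(_ [set x | 0 < x]); apply.
    exact: lt_nbhsr.
  rewrite /powR (negbTE P0).
  apply: (continuous_comp (f := fun q => a * ln (sqnorm q.1)) (g := expR));
    last exact: continuous_expR.
  apply: cvgM; first exact: cvg_cst.
  by apply: continuous_comp; [exact: c1|exact: continuous_ln].
rewrite /continuous_at P0 powR0 ?gt_eqF//.
apply/cvgr0Pnorm_le => e e0; near=> q.
rewrite ger0_norm ?powR_ge0//.
have -> : e = (e `^ a^-1) `^ a by rewrite -powRrM mulVf ?gt_eqF// powRr1// ltW.
suff le : sqnorm q.1 <= e `^ a^-1.
  by apply: (ge0_ler_powR (ltW a0)) le; rewrite nnegrE ?sqnorm_ge0 ?powR_ge0.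
apply: ltW; near: q; have := c1 p; rewrite /continuous_at P0 => /(_ [set x | x < e `^ a^-1]); apply.
by apply: lt_nbhsl; rewrite powR_gt0.
Unshelve. all: by end_near. Qed.

Lemma continuous_first_integral : continuous first_integral.
Proof.
move=> p; apply: cvgM; last exact: continuous_sqnorm2.
by apply: continuous_powR_sqnorm1; rewrite oppr_gt0.
Qed.

(** In the direction y the two factors are multiplied by e^(2 lambda t) and e^(-2 lambda t). *)
Lemma first_integral_flow b t p :
  first_integral (leaf_flow lambda (leaf_dir b t) p) = first_integral p.
Proof.
rewrite /first_integral sqnorm_flow1 sqnorm_flow2.
rewrite powRM ?expR_ge0 ?sqnorm_ge0// -expRM.
rewrite mulrACA -expRD; case: b; last by rewrite mul0r addr0 expR0 mul1r.
by rewrite (_ : _ + _ = 0) ?expR0 ?mul1r//; ring.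
Qed.

Lemma first_integral_eq0 p : first_integral p = 0 -> p.1 = 0 \/ p.2 = 0.
Proof.
have sq0 (a : C1 R) : sqnorm a = 0 -> a = 0.
  case: a => x y; rewrite /sqnorm/= => /eqP.
  by rewrite paddr_eq0 ?sqr_ge0// !sqrf_eq0 => /andP[/eqP -> /eqP ->].
move/eqP; rewrite mulf_eq0 => /orP[|/eqP/sq0]; last by right.
by rewrite powR_eq0 => /andP[/eqP/sq0]; left.
Qed.

Lemma leafwise_smooth_first_integral (h : R -> R) : continuous h ->
  leafwise_smooth lambda (fun p => h (first_integral p)).
Proof.
move=> ch; apply: leafwise_constant_smooth => [p|b t p]; last by rewrite first_integral_flow.
by apply: continuous_comp; [exact: continuous_first_integral|exact: ch].
Qed.

End FirstIntegral.

(** * Test functions and the mass form on the leaves *)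

Section TestFunctions.
Variables (R : realType) (lambda : R).
Implicit Types (f g : C2 R -> R) (p : C2 R).

Lemma compactly_supported_in_sub (A B : set (C2 R)) f : A `<=` B ->
  compactly_supported_in A f -> compactly_supported_in B f.
Proof. by move=> AB [K [cK KA fK]]; exists K; split=> //; exact: subset_trans AB. Qed.

Lemma test_funM f g : test_fun lambda f -> leafwise_smooth lambda g ->
  test_fun lambda (fun p => f p * g p).
Proof.
move=> [fs [K [cK KA fK]]] gs; split; first exact: leafwise_smoothM.
by exists K; split=> // p Kp; rewrite fK ?mul0r.
Qed.

Lemma test_funZ c f : test_fun lambda f -> test_fun lambda (fun p => c * f p).
Proof.
move=> [fs [K [cK KA fK]]]; split; first exact: leafwise_smoothZ.
by exists K; split=> // p Kp; rewrite fK ?mulr0.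
Qed.

Lemma test_funD f g : test_fun lambda f -> test_fun lambda g ->
  test_fun lambda (fun p => f p + g p).
Proof.
move=> [fs [K [cK KA fK]]] [gs [L [cL LA gL]]]; split; first exact: leafwise_smoothD.
exists (K `|` L); split; first exact: compactU.
  by move=> p [/KA|/LA].
by move=> p /not_orP[Kp Lp]; rewrite fK// gL// addr0.
Qed.

Lemma test_fun_continuous f : test_fun lambda f -> continuous f.
Proof. by move=> [fs _]; exact: (fs [::]).1. Qed.

(** On a pair (u, i u) the form is twice the squared norm of u; here u is i times the vector field,
    with components of moduli |z| and |lambda w|. *)
Lemma leaf_restrict_beta p : leaf_restrict lambda (@beta_form R) p =
  2 * (sqnorm p.1 + lambda ^+ 2 * sqnorm p.2).
Proof.
rewrite /leaf_restrict /beta_form /sqnorm /c2scale /cmul /ci /vfield.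
by rewrite /GRing.scale/= /GRing.scale/=; ring.
Qed.

Lemma leafwise_smooth_beta : leafwise_smooth lambda (leaf_restrict lambda (@beta_form R)).
Proof.
rewrite (_ : leaf_restrict _ _ = fun p => 2 * (sqnorm p.1 + lambda ^+ 2 * sqnorm p.2)).
  apply/leafwise_smoothZ/leafwise_smoothD/leafwise_smoothZ/leafwise_smooth_sqnorm2.
  exact: leafwise_smooth_sqnorm1.
by apply/funext => p; exact: leaf_restrict_beta.
Qed.

Lemma punctured_bidisc_sqnorm p : @punctured_bidisc R p -> 0 < sqnorm p.1 + sqnorm p.2.
Proof.
move=> [_ p0]; rewrite lt_neqAle eq_sym addr_ge0 ?sqnorm_ge0// andbT.
apply/negP; rewrite paddr_eq0 ?sqnorm_ge0// /sqnorm => /andP[].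
rewrite !paddr_eq0 ?sqr_ge0// !sqrf_eq0.
move: p p0 => [[a b] [c d]]/= p0 /andP[/eqP a0 /eqP b0] /andP[/eqP c0 /eqP d0].
by apply: p0; rewrite a0 b0 c0 d0.
Qed.

Lemma cmod_lt (a : C1 R) r : cmod a < r -> sqnorm a < r ^+ 2.
Proof.
rewrite /cmod -/(sqnorm a) => ar.
rewrite -[ltLHS](sqr_sqrtr (sqnorm_ge0 a)) ltr_pXn2r// ?nnegrE ?sqrtr_ge0//.
exact: le_trans (sqrtr_ge0 _) (ltW ar).
Qed.

Lemma sqnorm_lt (a : C1 R) r : 0 < r -> sqnorm a < r ^+ 2 -> cmod a < r.
Proof.
move=> r0 ar; rewrite /cmod -/(sqnorm a) -(ltr_pXn2r (n := 2))// ?nnegrE ?sqrtr_ge0 ?ltW//.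
by rewrite sqr_sqrtr ?sqnorm_ge0.
Qed.

Lemma open_polydisc (r : R) : 0 < r -> open (@polydisc R r).
Proof.
move=> r0; rewrite (_ : polydisc r =
  [set p | sqnorm p.1 < r ^+ 2] `&` [set p | sqnorm p.2 < r ^+ 2]).
  apply: openI.
    have /continuousP/(_ _ (@open_lt _ (r ^+ 2))) := @continuous_sqnorm1 R; exact.
  have /continuousP/(_ _ (@open_lt _ (r ^+ 2))) := @continuous_sqnorm2 R; exact.
by apply/seteqP; split => p [h1 h2]; split; by [exact: cmod_lt|exact: sqnorm_lt].
Qed.

End TestFunctions.

(** * Positivity of the current and smallness near the separatrices *)

Section Current.
Variables (R : realType) (lambda : R) (T : leaf_form R -> R).
Hypothesis hlambda : lambda < 0.
Hypothesis hT : directed_harmonic_current lambda T.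
Implicit Types (f g : C2 R -> R) (p : C2 R).

Local Notation beta := (leaf_restrict lambda (@beta_form R)).
Local Notation I := (first_integral lambda).

Lemma current0 : T (fun=> 0) = 0.
Proof.
have t0 : test_fun lambda (fun=> 0 : R).
  split; first exact: leafwise_smooth_cst.
  by exists set0; split=> //; exact: compact0.
have := dhc_linear hT (-1) t0 t0; rewrite (_ : (fun p : C2 R => -1 * 0 + 0 : R) = fun=> 0).
  by move=> ->; rewrite mulN1r addNr.
by apply/funext => p; rewrite mulr0 addr0.
Qed.

Lemma currentZ c f : test_fun lambda f -> T (fun p => c * f p) = c * T f.
Proof.
move=> tf; have t0 := test_funZ 0 tf; have := dhc_linear hT c tf t0.
rewrite (_ : (fun p => 0 * f p) = fun=> 0); last by apply/funext => p; rewrite mul0r.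
rewrite current0 addr0 => <-; congr T.
by apply/funext => p; rewrite mul0r addr0.
Qed.

Lemma currentD f g : test_fun lambda f -> test_fun lambda g ->
  T (fun p => f p + g p) = T f + T g.
Proof.
move=> tf tg; rewrite -[T f]mul1r -(dhc_linear hT 1 tf tg); congr T.
by apply/funext => p; rewrite mul1r.
Qed.

Lemma current_le f g : test_fun lambda f -> test_fun lambda g ->
  (forall p, f p <= g p) -> T f <= T g.
Proof.
move=> tf tg fg; rewrite -subr_ge0 addrC -mulN1r -(dhc_linear hT (-1) tf tg).
apply: (dhc_positive hT).
  by apply: test_funD => //; exact: test_funZ.
by move=> p; rewrite mulN1r addrC subr_ge0.
Qed.

(** A null set has an open neighbourhood [U] of small mass, and by compactness the points of [K]
    with small first integral lie in [U]. The mass of [U] then controls the current, as the mass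
    form is bounded below on [K]. The level [d] does not depend on the cutoff [h]. *)
Lemma current_small_near (S K : set (C2 R)) f theta : mass lambda T S = 0%E ->
  leafwise_smooth lambda f -> (forall p, 0 <= f p) ->
  compact K -> K `<=` @punctured_bidisc R -> (forall p, ~ K p -> f p = 0) ->
  (forall p, K p -> I p = 0 -> S p) ->
  0 < theta -> (forall p, K p -> theta <= beta p) ->
  forall e, 0 < e -> exists2 d, 0 < d &
  forall h : R -> R, continuous h -> (forall x, 0 <= h x <= 1) ->
    (forall x, d <= x -> h x = 0) -> T (fun p => f p * h (I p)) <= e.
Proof.
move=> S0 fs f0 cK Kpb fK KS t0 Kt e e0.
have [M M0 fM] := compact_upper_bound cK (fs [::]).1.
have : (mass lambda T S < (e * theta / M)%:E)%E by rewrite S0 lte_fin divr_gt0// mulr_gt0.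
move=> /ereal_inf_lt[_ [U [oU SU] <-] Ue].
have [d d0 dU] : exists2 d, 0 < d & forall p, K p -> I p <= d -> U p.
  apply: compact_sublevel => //; [exact: continuous_first_integral|exact: first_integral_ge0|].
  by move=> p Kp Ip; apply: SU; split; [exact: KS|exact: Kpb].
exists d => // h ch h01 hd.
(* Divided by the bound [M] of [f], the function becomes a cutoff admissible in the supremum
   defining [open_mass]. *)
pose c p := M^-1 * (f p * h (I p)).
have hs : leafwise_smooth lambda (fun p => h (I p)) by exact: leafwise_smooth_first_integral.
have fhs : leafwise_smooth lambda (fun p => f p * h (I p)) by exact: leafwise_smoothM.
have cs : compactly_supported_in (U `&` @punctured_bidisc R) c.
  exists (K `&` [set p | I p <= d]); split.
  - apply: compact_closedI => //; apply: closed_sublevel; exact: continuous_first_integral.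
  - by move=> p [Kp Ip]; split; [exact: dU|exact: Kpb].
  - move=> p KI; rewrite /c; have [Kp|Kp] := pselect (K p); last by rewrite fK// mul0r mulr0.
    have [Ip|Ip] := leP (I p) d; first by exfalso; apply: KI.
    by rewrite hd ?mulr0// ltW.
have tc : test_fun lambda c.
  split; first exact: leafwise_smoothZ.
  by apply: compactly_supported_in_sub cs => p [].
have c01 p : 0 <= c p <= 1.
  have /andP[h0 h1] := h01 (I p).
  apply/andP; split; first by rewrite !mulr_ge0// invr_ge0 ltW.
  rewrite /c ler_pdivrMl// mulr1.
  have [Kp|Kp] := pselect (K p); last by rewrite fK// mul0r ltW.
  by apply: le_trans (fM p Kp); rewrite ler_piMr.
have Tc : T (fun p => c p * beta p) <= e * theta / M.
  rewrite -lee_fin; apply: le_trans (ltW Ue); apply: ereal_sup_ubound.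
  by exists c.
have tfh : test_fun lambda (fun p => f p * h (I p)).
  by split => //; exists K; split => // p Kp; rewrite fK ?mul0r.
have tcb : test_fun lambda (fun p => c p * beta p).
  exact: (test_funM tc (leafwise_smooth_beta lambda)).
have key : T (fun p => f p * h (I p)) <= T (fun p => (M / theta) * (c p * beta p)).
  apply: current_le; [exact: tfh|exact: test_funZ tcb|].
  move=> p; rewrite /c.
  have -> : M / theta * (M^-1 * (f p * h (I p)) * beta p) = (f p * h (I p)) * (beta p / theta).
    by field; rewrite !gt_eqF.
  have [Kp|Kp] := pselect (K p); last by rewrite fK// !mul0r.
  have /andP[h0 _] := h01 (I p).
  by rewrite ler_peMr ?mulr_ge0// ler_pdivlMr// mul1r Kt.
rewrite currentZ// in key; apply: le_trans key _.
apply: le_trans (ler_wpM2l _ Tc) _; first by rewrite divr_ge0 ?ltW.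
by rewrite le_eqVlt; apply/orP; left; apply/eqP; field; rewrite !gt_eqF.
Qed.

Hypothesis hsep : no_mass_on_separatrices lambda T.

(** The support of [f] avoids the origin, so [f] is dominated by a sum of two pieces, one living
    where |z| is bounded below and one where |w| is. Each piece meets a single separatrix. *)
Lemma current_small_near_separatrices f e : test_fun lambda f -> (forall p, 0 <= f p) -> 0 < e ->
  exists2 d, 0 < d & forall h : R -> R, continuous h -> (forall x, 0 <= h x <= 1) ->
    (forall x, d <= x -> h x = 0) -> T (fun p => f p * h (I p)) <= e.
Proof.
move=> tf f0 e0; have [fs [K [cK Kpb fK]]] := tf; have [S1 S2] := hsep.
have c1 := @continuous_sqnorm1 R; have c2 := @continuous_sqnorm2 R.
have [t t0 Kt] : exists2 t, 0 < t & forall p, K p -> t <= sqnorm p.1 + sqnorm p.2.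
  apply: compact_positive_lower_bound => //.
    by move=> p; apply: cvgD; [exact: c1|exact: c2].
  by move=> p /Kpb; exact: punctured_bidisc_sqnorm.
(* A quarter of the lower bound [t] makes at least one squared modulus exceed [th] strictly at each
   point of [K]. *)
pose th := t / 4; have th0 : 0 < th by rewrite divr_gt0.
pose b (x : R) := flat 0 (x - th).
have b0 x : 0 <= b x by exact: flat_ge0.
have bs g : leafwise_smooth lambda g -> leafwise_smooth lambda (fun p => b (g p)).
  move=> gs; apply: (leafwise_smooth_comp (smooth_flat (fun=> True)) (fun=> Logic.I)).
  exact: (leafwise_smoothB gs (leafwise_smooth_cst lambda th)).
have b1s := bs _ (leafwise_smooth_sqnorm1 lambda).
have b2s := bs _ (leafwise_smooth_sqnorm2 lambda).
have [c c0 Kc] : exists2 c, 0 < c & forall p, K p -> c <= b (sqnorm p.1) + b (sqnorm p.2).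
  apply: compact_positive_lower_bound => //.
    by move=> p; apply: cvgD; [exact: (b1s [::]).1|exact: (b2s [::]).1].
  move=> p /Kt tp; have [p1|p1] := ltP (2 * th) (sqnorm p.1).
    by apply: ltr_pwDl => //; apply: flat0_gt0; rewrite subr_gt0; lra.
  by apply: ltr_pwDr => //; apply: flat0_gt0; rewrite subr_gt0; rewrite /th in p1 *; lra.
(* The common treatment of both pieces; the target [c * e / 2] makes their sum [c * e], and [c] is
   the lower bound of the sum of the two bumps on [K]. *)
have part (S : set (C2 R)) (N : C2 R -> R) : mass lambda T S = 0%E -> continuous N ->
    leafwise_smooth lambda (fun p => b (N p)) ->
    (forall p, th <= N p -> I p = 0 -> S p) ->
    (exists2 theta, 0 < theta & forall p, th <= N p -> theta <= beta p) ->
    exists2 d, 0 < d & forall h : R -> R, continuous h -> (forall x, 0 <= h x <= 1) ->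
    (forall x, d <= x -> h x = 0) -> T (fun p => (f p * b (N p)) * h (I p)) <= c * e / 2.
  move=> S0 cN Ns NS [theta theta0 Nt].
  apply: (@current_small_near S (K `&` [set p | th <= N p]) (fun p => f p * b (N p)) theta).
  - exact: S0.
  - exact: leafwise_smoothM fs Ns.
  - by move=> p; rewrite mulr_ge0.
  - by apply: compact_closedI => //; exact: closed_superlevel.
  - by move=> p [/Kpb].
  - move=> p /not_andP[/fK ->|/negP]; first by rewrite mul0r.
    by rewrite -ltNge => pt; rewrite /b flat_le0 ?mulr0// subr_le0 ltW.
  - by move=> p [_]; exact: NS.
  - exact: theta0.
  - by move=> p [_]; exact: Nt.
  - by rewrite divr_gt0// mulr_gt0.
have l2 : 0 < lambda ^+ 2 by rewrite exprn_even_gt0//= lt_eqF.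
have [] := part _ (fun p => sqnorm p.1) S2 c1 b1s.
- move=> p tp Ip /=; have [p1|//] := first_integral_eq0 Ip.
  by move: tp; rewrite p1 /sqnorm/= expr0n/= addr0 leNgt th0.
- exists th => // p tp; rewrite leaf_restrict_beta.
  have := mulr_ge0 (ltW l2) (sqnorm_ge0 p.2); lra.
move=> d1 d10 h1.
have [] := part _ (fun p => sqnorm p.2) S1 c2 b2s.
- move=> p tp Ip /=; have [//|p1] := first_integral_eq0 Ip.
  by move: tp; rewrite p1 /sqnorm/= expr0n/= addr0 leNgt th0.
- exists (lambda ^+ 2 * th); first exact: mulr_gt0.
  move=> p tp; rewrite leaf_restrict_beta.
  have := ler_wpM2l (ltW l2) tp; have := mulr_ge0 (ltW l2) (ltW th0).
  have := sqnorm_ge0 p.1; lra.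
move=> d2 d20 h2.
exists (Num.min d1 d2); first by rewrite lt_min d10.
move=> h ch h01 hd.
have H1 : T (fun p => f p * b (sqnorm p.1) * h (I p)) <= c * e / 2.
  by apply: h1 => // x dx; apply: hd; rewrite ge_min dx.
have H2 : T (fun p => f p * b (sqnorm p.2) * h (I p)) <= c * e / 2.
  by apply: h2 => // x dx; apply: hd; rewrite ge_min dx orbT.
have hs : leafwise_smooth lambda (fun p => h (I p)) by exact: leafwise_smooth_first_integral.
have t1 : test_fun lambda (fun p => f p * b (sqnorm p.1) * h (I p)).
  exact: (test_funM (test_funM tf b1s) hs).
have t2 : test_fun lambda (fun p => f p * b (sqnorm p.2) * h (I p)).
  exact: (test_funM (test_funM tf b2s) hs).
have key : T (fun p => f p * h (I p)) <= T (fun p => c^-1 *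
   (f p * b (sqnorm p.1) * h (I p) + f p * b (sqnorm p.2) * h (I p))).
  apply: current_le; [exact: test_funM|by apply: test_funZ; exact: test_funD|].
  move=> p; have [Kp|Kp] := pselect (K p); last by rewrite fK// !mul0r addr0 mulr0.
  rewrite ler_pdivlMl// -mulrDl -mulrDr mulrA [c * _]mulrC.
  have /andP[h0 _] := h01 (I p).
  by rewrite ler_wpM2r// ler_wpM2l// Kc.
apply: le_trans key _; rewrite currentZ; last exact: test_funD.
rewrite currentD// ler_pdivrMl//; lra.
Qed.

End Current.

(** * A smooth plateau function *)

Section Plateau.
Variable R : realType.
Implicit Types x : R.

Definition plateau x : R :=
  flat 0 (2^-1 - x) / (flat 0 (2^-1 - x) + flat 0 (x - 4^-1)).

Lemma plateau_den x : 0 < flat 0 (2^-1 - x) + flat 0 (x - 4^-1) :> R.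
Proof.
(* 3/8 is the midpoint of 1/4 and 1/2: to its left the first summand is positive, from it on the
   second. *)
have [x2|x2] := ltP x (3 / 8).
  by rewrite ltr_pwDl ?flat_ge0// flat0_gt0//; lra.
by rewrite ltr_pwDr ?flat_ge0// flat0_gt0//; lra.
Qed.

Lemma plateau_ge0 x : 0 <= plateau x.
Proof. by rewrite divr_ge0 ?flat_ge0// ltW// plateau_den. Qed.

Lemma plateau_eq1 x : x <= 4^-1 -> plateau x = 1.
Proof.
move=> x4; have := plateau_den x; rewrite /plateau.
rewrite [flat 0 (x - _)]flat_le0 ?addr0; last by rewrite subr_le0.
by move=> d; rewrite mulfV// gt_eqF.
Qed.

Lemma plateau_eq0 x : 2^-1 <= x -> plateau x = 0.
Proof. by move=> x2; rewrite /plateau flat_le0 ?mul0r// subr_le0. Qed.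

Lemma leafwise_smooth_flat0 (lambda : R) f : leafwise_smooth lambda f ->
  leafwise_smooth lambda (fun p => flat 0 (f p)).
Proof. exact: leafwise_smooth_comp (smooth_flat (fun=> True)) _. Qed.

Lemma leafwise_smooth_plateau (lambda : R) f : leafwise_smooth lambda f ->
  leafwise_smooth lambda (fun p => plateau (f p)).
Proof.
move=> fs.
have s1 : leafwise_smooth lambda (fun p => flat 0 (2^-1 - f p)).
  exact/leafwise_smooth_flat0/(leafwise_smoothB (leafwise_smooth_cst lambda _) fs).
have s2 : leafwise_smooth lambda (fun p => flat 0 (f p - 4^-1)).
  exact/leafwise_smooth_flat0/(leafwise_smoothB fs (leafwise_smooth_cst lambda _)).
apply: (leafwise_smoothM s1).
apply: (leafwise_smooth_comp (@smooth_inv R)); last exact: leafwise_smoothD s1 s2.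
by move=> p; exact: plateau_den.
Qed.

End Plateau.

(** * Locality of leaf derivatives *)

Section LocalDerivative.
Variables (R : realType) (lambda : R).
Implicit Types (f : C2 R -> R) (p : C2 R).

Lemma near_flow (N : C2 R -> R) N' (A : set R) b p :
  leaf_is_derive lambda b N N' -> open A -> A (N p) ->
  \forall t \near (0 : R), A (N (leaf_flow lambda (leaf_dir b t) p)).
Proof.
move=> hN oA Ap; have := is_derive_continuous (hN p) => /(_ A); apply.
by rewrite /along_leaf leaf_flow0; exact: open_nbhs_nbhs.
Qed.

Lemma leaf_derive_near_cst b f p (c : R) :
  (\forall t \near (0 : R), f (leaf_flow lambda (leaf_dir b t) p) = c) ->
  leaf_derive lambda b f p = 0.
Proof.
move=> h; rewrite /leaf_derive derive1E.
rewrite (@near_eq_derive R R R (along_leaf lambda b f p) (fun=> c))//.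
by rewrite derive_cst.
Qed.

End LocalDerivative.

(** * The plateau on the bidisc, the collar and the potential *)

Section MainEstimate.
Variables (R : realType) (lambda : R).
Implicit Types (p : C2 R) (s r : R).

Local Notation P p := (sqnorm p.1).
Local Notation Q p := (sqnorm p.2).
Local Notation I := (first_integral lambda).
Local Notation smooth := (leafwise_smooth lambda).

Definition bidisc_plateau p : R := plateau (P p) * plateau (Q p).

Local Notation k := bidisc_plateau.
Local Notation k1 := (leaf_derive lambda true bidisc_plateau).
Local Notation k2 := (leaf_derive lambda true (leaf_derive lambda true bidisc_plateau)).

Let smoothP : smooth (fun p => P p) := leafwise_smooth_sqnorm1 lambda.
Let smoothQ : smooth (fun p => Q p) := leafwise_smooth_sqnorm2 lambda.

Lemma smooth_k : smooth k.
Proof. by apply: leafwise_smoothM; exact: leafwise_smooth_plateau. Qed.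

Lemma k_ge0 p : 0 <= k p.
Proof. by rewrite mulr_ge0 ?plateau_ge0. Qed.

(** Off this region a strict inequality holds at [p], persists for short times along the leaf, and
    keeps the cutoff at 0 or at 1. *)
Lemma k_derive_eq0 p : ~ (P p <= 2^-1 /\ Q p <= 2^-1 /\ 4^-1 <= P p + Q p) ->
  k1 p = 0 /\ k2 p = 0.
Proof.
have hP := @sqnorm1_is_derive R lambda true; have hQ := @sqnorm2_is_derive R lambda true.
(* The first derivative vanishes on all of [N], not only at [p], so the same argument applies to it
   and yields the second. *)
have gen (N : set (C2 R)) c :
    (forall q, N q -> \forall t \near (0 : R), N (leaf_flow lambda (leaf_dir true t) q)) ->
    (forall q, N q -> k q = c) -> N p -> k1 p = 0 /\ k2 p = 0.
  move=> oN Nk Np.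
  have N1 q : N q -> k1 q = 0.
    move=> /oN nq; apply: (@leaf_derive_near_cst _ _ _ _ _ c).
    by apply: filterS nq => t; exact: Nk.
  split; first exact: N1.
  apply: (@leaf_derive_near_cst _ _ _ _ _ 0).
  by apply: filterS (oN _ Np) => t; exact: N1.
have oG : open [set x : R | 2^-1 < x] by exact: open_gt.
have oL : open [set x : R | x < 4^-1] by exact: open_lt.
move=> nS; have [Pp|Pp] := ltP 2^-1 (P p).
  apply: (gen [set q | 2^-1 < P q] 0) => //.
    by move=> q /=; exact: (near_flow hP oG).
  by move=> q /= Pq; rewrite /bidisc_plateau plateau_eq0 ?mul0r// ltW.
have [Qp|Qp] := ltP 2^-1 (Q p).
  apply: (gen [set q | 2^-1 < Q q] 0) => //.
    by move=> q /=; exact: (near_flow hQ oG).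
  by move=> q /= Pq; rewrite /bidisc_plateau [plateau (Q q)]plateau_eq0 ?mulr0// ltW.
apply: (gen [set q | P q + Q q < 4^-1] 1) => //.
- by move=> q /=; exact: (near_flow (leaf_is_deriveD hP hQ) oL).
- move=> q /=; have := sqnorm_ge0 q.1; have := sqnorm_ge0 q.2 => Pq Qq PQ.
  by rewrite /bidisc_plateau !plateau_eq1 ?mulr1//; lra.
- by rewrite /= ltNge; apply/negP => PQ; apply: nS.
Qed.

(** A test function that is positive on the compact region where the derivatives of the plateau may
    be nonzero: there both squared moduli are at most 1/2 and one of them is at least 1/8. *)
Definition collar p : R := (flat 0 (P p - 16^-1) + flat 0 (Q p - 16^-1)) *
  (flat 0 (3 / 4 - P p) * flat 0 (3 / 4 - Q p)).

Lemma collar_ge0 p : 0 <= collar p.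
Proof. by rewrite mulr_ge0 ?addr_ge0 ?mulr_ge0 ?flat_ge0. Qed.

Lemma test_fun_collar : test_fun lambda collar.
Proof.
have sflat c f : smooth f -> smooth (fun p => flat 0 (c - f p)).
  by move=> fs; exact/leafwise_smooth_flat0/(leafwise_smoothB (leafwise_smooth_cst lambda c) fs).
have sflat' c f : smooth f -> smooth (fun p => flat 0 (f p - c)).
  by move=> fs; exact/leafwise_smooth_flat0/(leafwise_smoothB fs (leafwise_smooth_cst lambda c)).
split.
  apply: leafwise_smoothM; first by apply: leafwise_smoothD; exact: sflat'.
  by apply: leafwise_smoothM; exact: sflat.
have c1 := @continuous_sqnorm1 R; have c2 := @continuous_sqnorm2 R.
have c12 : continuous (fun p => P p + Q p) by move=> p; apply: cvgD; [exact: c1|exact: c2].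
exists ([set p | P p <= 3 / 4] `&` [set p | Q p <= 3 / 4] `&` [set p | 16%:R^-1 <= P p + Q p]).
split.
- apply: compact_sqnorm_le1.
    by apply: closedI; [apply: closedI; exact: closed_sublevel|exact: closed_superlevel].
  by move=> p [[/= h1 h2] _]; split; lra.
- move=> p [[/= h1 h2] h3]; split; last first.
    move=> p0; move: h3; rewrite p0 /sqnorm/= !expr0n/= !addr0; lra.
  by split; apply: sqnorm_lt => //; rewrite expr1n; lra.
- move=> p h; rewrite /collar.
  have [h1|h1] := leP (P p) (3 / 4); last first.
    by rewrite [X in _ * (X * _)]flat_le0 ?mul0r ?mulr0//; lra.
  have [h2|h2] := leP (Q p) (3 / 4); last first.
    by rewrite [X in _ * (_ * X)]flat_le0 ?mulr0//; lra.
  have [h3|h3] := leP 16%:R^-1 (P p + Q p); first by exfalso; apply: h.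
  by have := sqnorm_ge0 p.1; have := sqnorm_ge0 p.2 => *;
     rewrite [flat 0 (P p - _)]flat_le0 1?[flat 0 (Q p - _)]flat_le0 ?addr0 ?mul0r//; lra.
Qed.

(* Here s is the square of the radius of a small bidisc.  The potential is
   superharmonic along the leaves, its Laplacian dominates the mass form divided
   by s on the bidisc, and on the leaves through this bidisc it is bounded near
   the boundary of the unit bidisc independently of s. *)
Definition potential s p : R := ln s - ln (s + P p) - ln (s + Q p).

(** The derivative of [potential s] in y. Each fraction x / (s + x) is written [1 - s * (s + x)^-1],
    which shows it to be at most 1 and is easy to differentiate again. *)
Definition potential1 s p : R :=
  2 * (1 - s * (s + P p)^-1) + 2 * lambda * (1 - s * (s + Q p)^-1).

Definition potential2 s p : R :=
  - (4 * s * P p * (s + P p) ^- 2 + 4 * lambda ^+ 2 * s * Q p * (s + Q p) ^- 2).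

Lemma smooth_potential s : 0 < s -> smooth (potential s).
Proof.
move=> s0; have sln f : smooth f -> (forall p, 0 <= f p) -> smooth (fun p => ln (s + f p)).
  move=> fs f0; apply: (leafwise_smooth_comp (@smooth_ln R)) => [p|].
    by rewrite ltr_pwDl.
  exact: (leafwise_smoothD (leafwise_smooth_cst lambda s) fs).
apply: leafwise_smoothB; last by apply: sln => // p; exact: sqnorm_ge0.
apply: leafwise_smoothB; first exact: leafwise_smooth_cst.
by apply: sln => // p; exact: sqnorm_ge0.
Qed.

Lemma potential_derive s : 0 < s ->
  leaf_is_derive lambda true (potential s) (potential1 s).
Proof.
move=> s0.
have sln f c : leaf_is_derive lambda true f (fun p => c * f p) -> (forall p, 0 <= f p) ->
    leaf_is_derive lambda true (fun p => - ln (s + f p)) (fun p => - c * (1 - s * (s + f p)^-1)).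
  move=> fd f0.
  have h1 := leaf_is_deriveD (leaf_is_derive_cst lambda true s) fd.
  have h2 := leaf_is_derive_comp (D := fun x : R => 0 < x) (@is_derive1_ln R)
    (fun p => ltr_pwDl s0 (f0 p)) h1.
  move=> p; apply: is_derive_eq (is_deriveN (h2 p)) _.
  by field; rewrite gt_eqF// ltr_pwDl.
have h1 := sln _ _ (@sqnorm1_is_derive R lambda true) (fun p => sqnorm_ge0 p.1).
have h2 := sln _ _ (@sqnorm2_is_derive R lambda true) (fun p => sqnorm_ge0 p.2).
move=> p; apply: is_derive_eq
  (leaf_is_deriveD (leaf_is_deriveD (leaf_is_derive_cst lambda true (ln s)) h1) h2 p) _.
by rewrite /potential1; ring.
Qed.

Lemma potential1_derive s : 0 < s ->
  leaf_is_derive lambda true (potential1 s) (potential2 s).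
Proof.
move=> s0.
have sinv f c d : leaf_is_derive lambda true f (fun p => c * f p) -> (forall p, 0 <= f p) ->
    leaf_is_derive lambda true (fun p => d * (1 - s * (s + f p)^-1))
      (fun p => d * s * c * f p * (s + f p) ^- 2).
  move=> fd f0 p.
  have dx (x : R) : 0 < x -> is_derive x 1 (fun y => d * (1 - s * y^-1)) (d * s * x ^- 2).
    move=> x0; have xn : x != 0 by rewrite gt_eqF.
    have g1 := is_derive1M (is_derive1_cst (- s) x) (is_derive1_inv_exp 1 xn).
    have g2 := is_derive1M (is_derive1_cst d x) (is_derive1D (is_derive1_cst 1 x) g1).
    rewrite (_ : (fun y => _) = fun y => d * (1 + - s * y ^- 1)); last first.
      by apply/funext => y; rewrite mulNr.
    apply: is_derive_eq g2 _; by field.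
  have h1 := leaf_is_deriveD (leaf_is_derive_cst lambda true s) fd.
  have h2 := leaf_is_derive_comp (D := fun x : R => 0 < x) dx (fun p => ltr_pwDl s0 (f0 p)) h1.
  apply: is_derive_eq (h2 p) _; ring.
have h1 := sinv _ _ 2 (@sqnorm1_is_derive R lambda true) (fun p => sqnorm_ge0 p.1).
have h2 := sinv _ _ (2 * lambda) (@sqnorm2_is_derive R lambda true) (fun p => sqnorm_ge0 p.2).
move=> p; apply: is_derive_eq (leaf_is_deriveD h1 h2 p) _.
by rewrite /potential2; ring.
Qed.

Lemma potential2_le0 s p : 0 < s -> potential2 s p <= 0.
Proof.
move=> s0; have := sqnorm_ge0 p.1; have := sqnorm_ge0 p.2 => Q0 P0.
have g x : 0 <= x -> 0 <= x * (s + x) ^- 2.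
  by move=> x0; rewrite mulr_ge0// invr_ge0 exprn_ge0// addr_ge0// ltW.
have l4 : 0 <= 4 * s by rewrite mulr_ge0// ltW.
have l5 : 0 <= 4 * lambda ^+ 2 * s.
  exact: (mulr_ge0 (mulr_ge0 (ler0n _ _) (sqr_ge0 _)) (ltW s0)).
rewrite /potential2 oppr_le0 -!(mulrA _ (sqnorm _)).
exact: (addr_ge0 (mulr_ge0 l4 (g _ P0)) (mulr_ge0 l5 (g _ Q0))).
Qed.

(** For [0 <= x <= s] one has [(s + x) ^+ 2 <= 4 * s ^+ 2]; this is applied to both squared
    moduli. *)
Lemma potential2_le s p : 0 < s -> P p <= s -> Q p <= s ->
  P p + lambda ^+ 2 * Q p <= - s * potential2 s p.
Proof.
move=> s0 Ps Qs; have := sqnorm_ge0 p.1; have := sqnorm_ge0 p.2 => Q0 P0.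
have g x : 0 <= x -> x <= s -> 1 <= 4 * s ^+ 2 * (s + x) ^- 2.
  move=> x0 xs; rewrite ler_pdivlMr ?exprn_gt0 ?ltr_pwDl// mul1r; nra.
rewrite /potential2 mulrNN.
have := ler_wpM2l P0 (g _ P0 Ps); have := ler_wpM2l (mulr_ge0 (sqr_ge0 lambda) Q0) (g _ Q0 Qs).
rewrite !mulr1 => h1 h2; apply: le_trans (lerD h2 h1) _.
by rewrite le_eqVlt; apply/orP; left; apply/eqP; ring.
Qed.

End MainEstimate.

(** * Uniform bounds, the barrier and the Lelong number *)

Section Estimate.
Variables (R : realType) (lambda : R).
Hypothesis hlambda : lambda < 0.
Implicit Types (p : C2 R) (s r : R).

Local Notation P p := (sqnorm p.1).
Local Notation Q p := (sqnorm p.2).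
Local Notation I := (first_integral lambda).
Local Notation smooth := (leafwise_smooth lambda).
Local Notation beta := (leaf_restrict lambda (@beta_form R)).
Local Notation k := (@bidisc_plateau R).
Local Notation k1 := (leaf_derive lambda true (@bidisc_plateau R)).
Local Notation k2 := (leaf_derive lambda true (leaf_derive lambda true (@bidisc_plateau R))).

(** With [s = r ^+ 2], this bounds the first integral on the bidisc of radius [r]. *)
Definition level s : R := s `^ (- lambda) * s.

Lemma level_gt0 s : 0 < s -> 0 < level s.
Proof. by move=> s0; rewrite mulr_gt0// powR_gt0. Qed.

Lemma powR_le1 s : 0 < s -> s <= 1 -> s `^ (- lambda) <= 1.
Proof.
move=> s0 s1; have l0 : 0 <= - lambda by rewrite oppr_ge0 ltW.
by have := ge0_ler_powR l0 _ _ s1; rewrite powR1; apply; rewrite nnegrE// ltW.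
Qed.

(** When [y] is at most a multiple of [s], [ln s] and [ln (s + y)] differ by a bounded amount, while
    [s + x] stays between 1/8 and 8. *)
Lemma ln_collar_bound s x y (L : R) : 0 < s -> s <= 1 -> 8^-1 <= x -> x <= 2^-1 ->
  0 <= y -> 0 <= L -> y <= L * s ->
  `|ln s - ln (s + x) - ln (s + y)| <= ln 8 + ln (1 + L).
Proof.
move=> s0 s1 x8 x2 y0 L0 yL.
have h1 : ln s <= ln (s + y) by rewrite ler_ln ?posrE//; lra.
have h2 : ln (s + y) <= ln (1 + L) + ln s.
  by rewrite -lnM ?posrE ?ler_ln ?posrE//; nra.
have h3 : ln (s + x) <= ln 8 by rewrite ler_ln ?posrE//; lra.
have h4 : - ln 8 <= ln (s + x).
  by rewrite -lnV ?posrE// ler_ln ?posrE//; lra.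
by rewrite ler_norml; apply/andP; split; lra.
Qed.

(** In the collar one squared modulus is at least 1/8; the bound on the first integral then makes
    the other one O(s). *)
Lemma potential_bound : exists B, forall s p, 0 < s -> s <= 1 -> I p <= 2 * level s ->
  P p <= 2^-1 -> Q p <= 2^-1 -> 4^-1 <= P p + Q p -> `|potential s p| <= B.
Proof.
have a0 : 0 < - lambda by rewrite oppr_gt0.
pose c := (8^-1 : R) `^ (- lambda).
have c0 : 0 < c by rewrite powR_gt0.
(* One summand for each case: |w|^2 is at most 2 s / c when |z|^2 is at least 1/8, and otherwise
   |z|^2 is at most s times the second summand. *)
pose L := 2 / c + 16 `^ (- lambda)^-1.
have L1 : 0 <= 2 / c by rewrite divr_ge0// ltW.
have L2 : 0 <= 16 `^ (- lambda)^-1 :> R by exact: powR_ge0.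
have L0 : 0 <= L by exact: addr_ge0.
exists (ln 8 + ln (1 + L)) => s p s0 s1 Ip P2 Q2 PQ.
have := sqnorm_ge0 p.1; have := sqnorm_ge0 p.2 => Q0 P0.
have sa := powR_le1 s0 s1; have sa0 : 0 < s `^ (- lambda) by rewrite powR_gt0.
have [P8|P8] := leP 8^-1 (P p).
  apply: ln_collar_bound => //.
  have cP : c <= P p `^ (- lambda).
    by apply: (ge0_ler_powR (ltW a0)) P8; rewrite nnegrE.
  have : c * Q p <= 2 * s.
    have := ler_wpM2r Q0 cP; move: Ip; rewrite /first_integral /level.
    have := ler_wpM2r (ltW s0) sa; lra.
  rewrite mulrC -ler_pdivlMr// => h; apply: le_trans h _.
  by rewrite mulrAC ler_wpM2r ?(ltW s0)// lerDl.
have Q8 : 8^-1 <= Q p by lra.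
rewrite /potential addrAC; apply: ln_collar_bound => //.
suff : P p <= 16 `^ (- lambda)^-1 * s.
  by move/le_trans; apply; rewrite ler_wpM2r ?(ltW s0)// lerDr.
rewrite leNgt; apply/negP => h.
have : (16 `^ (- lambda)^-1 * s) `^ (- lambda) < P p `^ (- lambda).
  by apply: (gt0_ltr_powR a0) h; rewrite nnegrE// mulr_ge0// ltW.
rewrite powRM ?(ltW s0)// -powRrM mulVf ?gt_eqF// powRr1//.
have := ler_wpM2l (powR_ge0 (P p) (- lambda)) Q8.
move: Ip; rewrite /first_integral /level.
have := ler_wpM2l (ltW sa0) s1; lra.
Qed.

Lemma potential1_bound s p : 0 < s -> `|potential1 lambda s p| <= 2 - 2 * lambda.
Proof.
move=> s0; have g x : 0 <= x -> 0 <= 1 - s * (s + x)^-1 <= 1.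
  move=> x0; have sx : 0 < s + x by rewrite ltr_pwDl.
  apply/andP; split.
    by rewrite subr_ge0 ler_pdivrMr// mul1r lerDl.
  by rewrite gerBl divr_ge0// ltW.
have /andP[u0 u1] := g _ (sqnorm_ge0 p.1); have /andP[v0 v1] := g _ (sqnorm_ge0 p.2).
rewrite /potential1; move: hlambda u0 u1 v0 v1.
move: (1 - s / (s + P p)) (1 - s / (s + Q p)) => u v l0 u0 u1 v0 v1.
by rewrite ler_norml; apply/andP; split; nra.
Qed.

(** The left-hand side collects the terms in which the plateau is differentiated. They live on a
    compact set where the collar has a positive lower bound, and their coefficients are bounded
    independently of [s]. *)
Lemma cutoff_error_bound : exists2 C, 0 < C & forall s p, 0 < s -> s <= 1 -> I p <= 2 * level s ->
  k2 p * potential s p + 2 * (k1 p * potential1 lambda s p) <= C * collar p.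
Proof.
have [B hB] := potential_bound.
have s1 : smooth k1 by apply: leafwise_smooth_derive; exact: smooth_k.
have s2 : smooth k2 by exact: leafwise_smooth_derive.
have cc1 := @continuous_sqnorm1 R; have cc2 := @continuous_sqnorm2 R.
have c12 : continuous (fun p => P p + Q p) by move=> p; apply: cvgD; [exact: cc1|exact: cc2].
pose S : set (C2 R) :=
  [set p | P p <= 2^-1] `&` [set p | Q p <= 2^-1] `&` [set p | 4^-1 <= P p + Q p].
have cS : compact S.
  apply: compact_sqnorm_le1.
    by apply: closedI; [apply: closedI; exact: closed_sublevel|exact: closed_superlevel].
  by move=> p [[/= h1 h2] _]; split; lra.
have cn f : smooth f -> continuous (fun p => `|f p|).
  by move=> fs p; apply: cvg_norm; exact: (fs [::]).1.
have [M1 M10 kM1] := compact_upper_bound cS (cn _ s1).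
have [M2 M20 kM2] := compact_upper_bound cS (cn _ s2).
have [c c0 cM] : exists2 c, 0 < c & forall p, S p -> c <= collar p.
  apply: compact_positive_lower_bound => //.
    exact: test_fun_continuous (test_fun_collar lambda).
  move=> p [[/= h1 h2] h3]; rewrite /collar.
  apply: mulr_gt0; last by apply: mulr_gt0; apply: flat0_gt0; lra.
  have [Pp|Pp] := ltP 16^-1 (P p).
    by apply: ltr_pwDl; rewrite ?flat_ge0//; apply: flat0_gt0; lra.
  by apply: ltr_pwDr; rewrite ?flat_ge0//; apply: flat0_gt0; lra.
pose D := M2 * `|B| + 2 * (M1 * (2 - 2 * lambda)).
have D0 : 0 < D.
  have h1 : 0 <= M2 * `|B| by rewrite mulr_ge0// ltW.
  have h2 : 0 < M1 * (2 - 2 * lambda).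
    by apply: mulr_gt0 => //; have := hlambda; lra.
  by rewrite /D; lra.
exists (D / c); first exact: divr_gt0.
move=> s p s0 sle1 Ip; have [Sp|Sp] := pselect (S p); last first.
  have [|-> ->] := @k_derive_eq0 R lambda p.
    by move=> [h1 [h2 h3]]; apply: Sp.
  by rewrite !mul0r mulr0 addr0 mulr_ge0 ?collar_ge0// ltW// divr_gt0.
apply: (@le_trans _ _ D); last first.
  by rewrite -mulrA ler_peMr ?(ltW D0)// ler_pdivlMl// mulr1 cM.
have [[/= h1 h2] h3] := Sp.
apply: le_trans (ler_norm _) _; apply: le_trans (ler_normD _ _) _.
rewrite !normrM (ger0_norm (ler0n _ 2)); apply: lerD.
  apply: ler_pM => //; first exact: kM2.
  by apply: le_trans (ler_norm B); exact: hB.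
rewrite ler_wpM2l//; apply: ler_pM => //; first exact: kM1.
exact: potential1_bound.
Qed.

Variable T : leaf_form R -> R.
Hypothesis hT : directed_harmonic_current lambda T.
Hypothesis hsep : no_mass_on_separatrices lambda T.

(** The potential is cut off along the leaves by the plateau and transversally by [h]. *)
Definition barrier (h : R -> R) s p : R := h (I p) * (k p * potential s p).

(** The factor [h (I p)] is constant on the leaves and everything is invariant in the direction x,
    so only the second derivative in y of a product remains. *)
Lemma leaf_iddbar_barrier (h : R -> R) s : 0 < s -> leaf_iddbar lambda (barrier h s) =
  fun p => 2^-1 * (h (I p) * (k2 p * potential s p + 2 * (k1 p * potential1 lambda s p)
                              + k p * potential2 lambda s p)).
Proof.
move=> s0; have hk := leafwise_smooth_is_derive true (smooth_k lambda).
have hk1 := leafwise_smooth_is_derive true (leafwise_smooth_derive true (smooth_k lambda)).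
have hp := potential_derive lambda s0; have hp1 := potential1_derive lambda s0.
have hI b : leaf_is_derive lambda b (fun p => h (I p)) (fun=> 0).
  by apply: leafwise_constant_is_derive => b' t p; rewrite first_integral_flow.
have kw := leaf_is_deriveM hk hp.
have kw2 := leaf_is_deriveD (leaf_is_deriveM hk1 hp) (leaf_is_deriveM hk hp1).
have F1 := leaf_is_deriveM (hI true) kw.
have F1' : leaf_derive lambda true (barrier h s) =
    fun p => h (I p) * (k1 p * potential s p + k p * potential1 lambda s p).
  by rewrite (leaf_is_derive_eq F1); apply/funext => p; rewrite mul0r add0r.
have F2 := leaf_is_deriveM (hI true) kw2.
have Fx : leaf_derive lambda false (barrier h s) = fun=> 0.
  apply: leaf_is_derive_eq => p.
  rewrite [along_leaf _ _ _ _](_ : _ = fun=> barrier h s p); first exact: is_derive1_cst.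
  apply/funext => t; rewrite /along_leaf /barrier /bidisc_plateau /potential.
  move: (sqnorm_flow1 lambda false t p) (sqnorm_flow2 lambda false t p).
  move: (first_integral_flow lambda false t p).
  by move: (leaf_flow _ _ p) => q /=; rewrite expR0 !mul1r => -> -> ->.
apply/funext => p; rewrite /leaf_iddbar /= Fx F1' (leaf_is_derive_eq F2).
rewrite (leaf_is_derive_eq (leaf_is_derive_cst lambda false 0)).
by ring.
Qed.

(** The plateau confines the support to a smaller closed bidisc, and the vanishing of [h] up to
    [eta] keeps it away from the origin. *)
Lemma test_fun_barrier (h : R -> R) s eta : continuous h -> 0 < eta ->
  (forall x, x <= eta -> h x = 0) ->
  0 < s -> test_fun lambda (barrier h s) /\ test_fun lambda (leaf_iddbar lambda (barrier h s)).
Proof.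
move=> ch eta0 heta s0.
have bs : smooth (barrier h s).
  apply: leafwise_smoothM; first exact: leafwise_smooth_first_integral.
  by apply: leafwise_smoothM; [exact: smooth_k|exact: smooth_potential].
have cc1 := @continuous_sqnorm1 R; have cc2 := @continuous_sqnorm2 R.
have cI := continuous_first_integral hlambda.
pose K : set (C2 R) := [set p | P p <= 2^-1] `&` [set p | Q p <= 2^-1] `&` [set p | eta <= I p].
have cK : compact K.
  apply: compact_sqnorm_le1.
    by apply: closedI; [apply: closedI; exact: closed_sublevel|exact: closed_superlevel].
  by move=> p [[/= h1 h2] _]; split; lra.
have Kpb : K `<=` @punctured_bidisc R.
  move=> p [[/= h1 h2] h3]; split; last first.
    move=> p0; move: h3; rewrite /first_integral p0.
    by rewrite [X in _ * X](_ : _ = 0) ?mulr0 ?leNgt ?eta0// /sqnorm/= expr0n addr0.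
  by split; apply: sqnorm_lt => //; rewrite expr1n; lra.
have Kk p : ~ K p -> h (I p) = 0 \/ (k p = 0 /\ k1 p = 0 /\ k2 p = 0).
  move=> Kp; have [Ip|Ip] := leP eta (I p); last by left; exact/heta/ltW.
  right; have kd : ~ (P p <= 2^-1 /\ Q p <= 2^-1).
    by move=> [h1 h2]; apply: Kp.
  split; last by apply: k_derive_eq0 => -[h1 [h2 _]]; exact: kd.
  rewrite /bidisc_plateau; have [Pp|Pp] := leP (P p) 2^-1.
    have [Qp|Qp] := leP (Q p) 2^-1; first by exfalso; apply: kd.
    by rewrite [plateau (Q p)]plateau_eq0 ?mulr0// ltW.
  by rewrite plateau_eq0 ?mul0r// ltW.
split; split.
- exact: bs.
- exists K; split=> [||p /Kk]; [exact: cK|exact: Kpb|].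
  case=> [h0|[k0 _]]; first by rewrite /barrier h0 mul0r.
  by rewrite /barrier k0 mul0r mulr0.
- apply: leafwise_smoothZ; apply: leafwise_smoothD;
  by do 2 apply: leafwise_smooth_derive.
- rewrite leaf_iddbar_barrier//; exists K; split=> [||p /Kk]; [exact: cK|exact: Kpb|].
  case=> [h0|[k0 [k10 k20]]].
    by rewrite h0 mul0r mulr0.
  by rewrite k0 k10 k20 !mul0r !mulr0 !addr0 !mulr0.
Qed.

(** The part of the mass very near the separatrices is negligible. The rest is dominated by a collar
    term minus a multiple of the Laplacian of the barrier, which the current annihilates. *)
Lemma open_mass_polydisc_le e : 0 < e -> exists2 r0, 0 < r0 &
  forall r, 0 < r -> r < r0 -> (open_mass lambda T (@polydisc R r) <= (e * r ^+ 2)%:E)%E.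
Proof.
move=> e0; have [C C0 hC] := cutoff_error_bound.
have e1 : 0 < e / (4 * C) by rewrite divr_gt0// mulr_gt0.
have [d d0 hd] := current_small_near_separatrices hlambda hT hsep
  (test_fun_collar lambda) (@collar_ge0 R) e1.
(* 1/2 places the small bidisc where the plateau is 1; [d / 2] gives [2 * level s <= d], through
   [level s <= s <= r]. *)
exists (Num.min 2^-1 (d / 2)); first by rewrite lt_min invr_gt0 ltr0n divr_gt0.
move=> r r0; rewrite lt_min => /andP[r2 rd].
pose s := r ^+ 2; have s0 : 0 < s by rewrite exprn_gt0.
have s4 : s <= 4^-1 by rewrite /s; nra.
have s1 : s <= 1 by lra.
have ld : 2 * level s <= d.
  have := ler_wpM2r (ltW s0) (powR_le1 s0 s1); rewrite -/(level s) mul1r => ls.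
  have sr : s <= r by rewrite /s; nra.
  lra.
have l0 := level_gt0 s0.
apply: ub_ereal_sup => _ [chi [tchi chi01 [K [cK KU chiK]]] <-].
rewrite lee_fin /mul_form -/s.
have tcb : test_fun lambda (fun p => chi p * beta p).
  by apply: test_funM => //; exact: leafwise_smooth_beta.
have beta0 p : 0 <= beta p.
  rewrite leaf_restrict_beta mulr_ge0// addr_ge0 ?sqnorm_ge0//.
  exact: (mulr_ge0 (sqr_ge0 _) (sqnorm_ge0 _)).
have es : 0 < e * s / 2 by rewrite divr_gt0// mulr_gt0.
have [|d' d'0 hd'] := current_small_near_separatrices hlambda hT hsep tcb _ es.
  by move=> p; rewrite mulr_ge0//; have /andP[] := chi01 p.
(* [ramp eta] vanishes from [2 * eta = d'] on, as the smallness statement requires. Here [eta]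
   depends on [chi], while [r0] does not. *)
pose eta := d' / 2; have eta0 : 0 < eta by rewrite divr_gt0.
have small : T (fun p => chi p * beta p * ramp eta (I p)) <= e * s / 2.
  apply: hd' => [|x|x xd]; first exact: continuous_ramp.
    by rewrite ramp_ge0 ramp_le1.
  by apply: ramp_eq0 => //; rewrite /eta; lra.
(* The first factor selects the leaves meeting the small bidisc, the second removes a neighbourhood
   of the separatrices. *)
pose h x := ramp (level s) x * (1 - ramp eta x).
have ch : continuous h.
  move=> x; apply: cvgM; first exact: continuous_ramp.
  by apply: cvgB; [exact: cvg_cst|exact: continuous_ramp].
have h01 x : 0 <= h x <= 1.
  have := ramp_ge0 (level s) x; have := ramp_le1 (level s) x.
  have := ramp_ge0 eta x; have := ramp_le1 eta x => *.
  by rewrite /h; apply/andP; split; nra.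
have hzero x : 2 * level s <= x -> h x = 0.
  by move=> xl; rewrite /h ramp_eq0// mul0r.
have collar_small : T (fun p => collar p * h (I p)) <= e / (4 * C).
  by apply: hd => // x dx; apply: hzero; exact: le_trans ld dx.
have heta x : x <= eta -> h x = 0.
  by move=> xe; rewrite /h (ramp_eq1 eta0 xe); ring.
have [tb tdb] := test_fun_barrier ch eta0 heta s0.
have tch : test_fun lambda (fun p => collar p * h (I p)).
  by apply: test_funM; [exact: test_fun_collar|exact: leafwise_smooth_first_integral].
have sr1 : smooth (fun p => ramp eta (I p)).
  by apply: leafwise_smooth_first_integral => //; exact: continuous_ramp.
have sr2 : smooth (fun p => 1 - ramp eta (I p)).
  exact: (leafwise_smoothB (leafwise_smooth_cst lambda 1) sr1).
have tcr1 := test_funM tcb sr1; have tcr2 := test_funM tcb sr2.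
(* The factor [- 4 * s] undoes the 1/2 in [leaf_iddbar] and the 1/s in the potential estimate, and
   supplies the 2 of the mass form; the collar term absorbs the cutoff error. *)
pose major p := (2 * s * C) * (collar p * h (I p)) +
  (- 4 * s) * leaf_iddbar lambda (barrier h s) p.
have tmajor : test_fun lambda major.
  exact: (test_funD (test_funZ (2 * s * C) tch) (test_funZ (- 4 * s) tdb)).
have main p : chi p * beta p * (1 - ramp eta (I p)) <= major p.
  rewrite /major leaf_iddbar_barrier//.
  have /andP[hp0 hp1] := h01 (I p); have k0 := @k_ge0 R p.
  have W2 := potential2_le0 lambda p s0.
  set E := k2 p * _ + _; set V := potential2 lambda s p in W2 *.
  have hE : h (I p) * E <= C * (collar p * h (I p)).
    have [Ip|Ip] := leP (2 * level s) (I p); first by rewrite hzero// mul0r !mulr0.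
    by rewrite mulrA mulrC; apply: ler_wpM2r => //; exact: hC (ltW Ip).
  have hV : chi p * beta p * (1 - ramp eta (I p)) <= 2 * (h (I p) * (k p * (- s * V))).
    have V0 : 0 <= h (I p) * (k p * (- s * V)).
      apply: (mulr_ge0 hp0 (mulr_ge0 k0 _)).
      by rewrite mulNr oppr_ge0; exact: (mulr_ge0_le0 (ltW s0) W2).
    have [Kp|Kp] := pselect (K p); last by rewrite chiK// !mul0r mulr_ge0.
    have [[/= /cmod_lt Pr /cmod_lt Qr] _] := KU _ Kp.
    have kp : k p = 1.
      by rewrite /bidisc_plateau !plateau_eq1 ?mulr1//; apply: le_trans (ltW _) s4.
    have Il : I p <= level s.
      apply: ler_pM; rewrite ?powR_ge0 ?sqnorm_ge0 ?(ltW Qr)//.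
      have la0 : 0 <= - lambda by rewrite oppr_ge0 ltW.
      by apply: (ge0_ler_powR la0) (ltW Pr); rewrite nnegrE ?sqnorm_ge0 ?(ltW s0).
    have := potential2_le lambda s0 (ltW Pr) (ltW Qr); rewrite -/V.
    rewrite {1}leaf_restrict_beta kp mul1r /h (ramp_eq1 l0 Il) mul1r.
    have r0' : 0 <= 1 - ramp eta (I p) by have := ramp_le1 eta (I p); lra.
    have := sqnorm_ge0 p.1; have := mulr_ge0 (sqr_ge0 lambda) (sqnorm_ge0 p.2) => Q0 P0 PV.
    have /andP[c0 c1] := chi01 p.
    set t := 1 - _ in r0' *; rewrite [leRHS](_ : _ = 2 * (- s * V) * t); last by ring.
    apply: (ler_wpM2r r0'); apply: le_trans (ler_piMl _ c1) _; lra.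
  apply: le_trans hV _.
  have := ler_wpM2l (ltW s0) hE; lra.
have T1 : T (fun p => chi p * beta p) = T (fun p => chi p * beta p * ramp eta (I p)) +
    T (fun p => chi p * beta p * (1 - ramp eta (I p))).
  by rewrite -(currentD hT tcr1 tcr2); congr T; apply/funext => p; ring.
(* Harmonicity removes the Laplacian; the collar term gives [2 * s * C * (e / (4 * C))]. *)
have T2 : T major <= e * s / 2.
  rewrite /major (currentD hT (test_funZ (2 * s * C) tch) (test_funZ (- 4 * s) tdb)).
  rewrite (currentZ hT _ tch) (currentZ hT _ tdb) (dhc_harmonic hT tb) mulr0 addr0.
  apply: le_trans (ler_wpM2l _ collar_small) _; first by rewrite !mulr_ge0 ?ltW.
  by rewrite le_eqVlt; apply/orP; left; apply/eqP; field; rewrite gt_eqF.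
by have := current_le hT tcr2 tmajor main; rewrite T1; lra.
Qed.

Lemma open_mass_ge0 (U : set (C2 R)) : (0 <= open_mass lambda T U)%E.
Proof.
apply: ereal_sup_ubound; exists (fun=> 0).
  have c0 (A : set (C2 R)) : compactly_supported_in A (fun=> 0).
    by exists set0; split => //; exact: compact0.
  split => //; last by move=> p; rewrite lexx ler01.
  by split; [exact: leafwise_smooth_cst|exact: c0].
rewrite (_ : mul_form _ _ = fun=> 0) ?(current0 hT)//.
by apply/funext => p; rewrite /mul_form mul0r.
Qed.

(** The upper limit is an infimum of suprema over punctured right neighbourhoods of 0, so one
    interval [0 < r < r0] suffices for each [e]. *)
Lemma lelong_number_eq0 : lelong_number lambda T = 0%E.
Proof.
have mass0 A : (0 <= mass lambda T A)%E.
  by apply: le_ereal_inf_tmp => _ [U _ <-]; exact: open_mass_ge0.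
apply/eqP; rewrite eq_le; apply/andP; split; last first.
  apply: limf_esup_ge0 => [|r]; first exact: filter_not_empty.
  by rewrite mule_ge0// lee_fin invr_ge0 mulr_ge0 ?pi_ge0 ?sqr_ge0.
apply/lee_addgt0Pr => e e0; rewrite add0e /lelong_number limf_esupE.
(* The factor [pi] cancels the one in the normalization of the Lelong number. *)
have pe : 0 < e * pi by rewrite mulr_gt0// pi_gt0.
have [r0 r00 hr] := open_mass_polydisc_le pe.
pose V := [set r : R | 0 < r < r0].
pose m r := (((pi * r ^+ 2)^-1)%:E * mass lambda T (@polydisc R r))%E.
apply: (@le_trans _ _ (ereal_sup (m @` V))).
  apply: ereal_inf_lbound; exists V => //.
  near=> r => /=; apply/andP; split; near: r; first exact: nbhs_right_gt.
  exact: nbhs_right_lt.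
apply: ub_ereal_sup => _ [r /= /andP[rp rr0] <-].
have pr : 0 < pi * r ^+ 2 by rewrite mulr_gt0 ?pi_gt0// exprn_gt0.
rewrite /m muleC.
apply: (@le_trans _ _ ((e * pi * r ^+ 2)%:E * ((pi * r ^+ 2)^-1)%:E)%E).
  apply: lee_wpmul2r; first by rewrite lee_fin invr_ge0 ltW.
  apply: le_trans (hr r rp rr0); apply: ereal_inf_lbound.
  exists (@polydisc R r) => //; split; first exact: open_polydisc.
  by move=> p [].
by rewrite -EFinM lee_fin -mulrA -mulrA mulfV ?mulr1// gt_eqF.
Unshelve. all: by end_near. Qed.

End Estimate.

Theorem theorem1p5 (R : realType) (lambda : R) (hlambda : lambda < 0)
    (T : leaf_form R -> R)
    (hT : directed_harmonic_current lambda T)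
    (hfin : (mass lambda T (@bidisc R) < +oo)%E)
    (hsep : no_mass_on_separatrices lambda T)
    (hext : trivial_extension_ddc_closed lambda T) :
  (periodic_current lambda T -> lelong_number lambda T = 0%E) /\
  ((exists q : rat, lambda = ratr q) -> lelong_number lambda T = 0%E).
Proof. by split => _; exact: lelong_number_eq0. Qed.
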